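(* Let $H\in\mathbb{H}^{n\times n}$ be an invertible Hermitian quaternion matrix and $X\in\mathbb{H}^{n\times n}$, and put $B=X^{[*]}X=H^{-1}X^*HX$ (which is $H$-selfadjoint). Then $X$ admits an $H$-polar decomposition if and only if all of the following hold. (i) In the canonical form of $(B,H)$, the blocks corresponding to negative eigenvalues can be grouped into pairs of the form $\left(J_{k}(\lambda)\oplus J_{k}(\lambda),\;Q_{k}\oplus(-Q_{k})\right)$ with $\lambda<0$. (ii) In the canonical form of $(B,H)$, the blocks corresponding to the eigenvalue $0$ can be grouped into blocks $(B_i,H_i)$ each of which is either of the form $\left(J_{k+1}(0)\oplus J_{k}(0),\;\eta Q_{k+1}\oplus\eta Q_{k}\right)$ with $\eta=\pm1$ and $k\ge 0$ (for $k=0$ this is a single block $(J_1(0),\eta)$), or of the form $\left(J_{k}(0)\oplus J_{k}(0),\;Q_{k}\oplus(-Q_{k})\right)$ with $k\ge1$. Collect all single blocks $J_1(0)$ into $B_0$, the $k_0\times k_0$ zero matrix, with $H_0$ the corresponding $k_0\times k_0$ diagonal matrix with entries $\pm1$, and denote the remaining zero-eigenvalue blocks by $B_1,\ldots,B_m$, with $\ell_i$ the order of $B_i$. (iii) There is a choice of basis of $\mathbb{H}^n$ producing the canonical form of $(B,H)$ with such a grouping, in which the basis vectors corresponding to $B_0$ are $e_{0,1},\ldots,e_{0,k_0}$ and those corresponding to $B_i$ ($i=1,\ldots,m$) are $e_{i,1},\ldots,e_{i,\ell_i}$, ordered so that the vectors of the first Jordan block of $B_i$ come first (i.e. if $B_i=J_p(0)\oplus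 J_q(0)$ then $e_{i,1},\ldots,e_{i,p}$ correspond to $J_p(0)$ and $e_{i,p+1},\ldots,e_{i,p+q}$ to $J_q(0)$), such that $$\mathrm{Ker}\,X=\mathrm{span}\{e_{i,1}+e_{i,k_i+1}\mid \ell_i=2k_i \text{ even},\ 1\le i\le m\}\oplus\mathrm{span}\{e_{i,1}\mid \ell_i \text{ odd},\ 1\le i\le m\}\oplus\mathrm{span}\{e_{0,j}\}_{j=1}^{k_0}.$$
   Context: $\mathbb{H}$ denotes the real quaternions, $\mathbb{H}^n$ is a right vector space, $A^*$ is the conjugate transpose. The $H$-adjoint is $X^{[*]}=H^{-1}X^*H$; $A$ is $H$-selfadjoint if $A^{[*]}=A$, $U$ is $H$-unitary if $U^*HU=H$; an $H$-polar decomposition of $X$ is $X=UA$ with $U$ $H$-unitary and $A$ $H$-selfadjoint. $J_k(\lambda)$ is the $k\times k$ upper triangular Jordan block with eigenvalue $\lambda$ (ones on the superdiagonal), and $Q_k$ is the $k\times k$ matrix with ones on the main anti-diagonal and zeros elsewhere. Canonical form: for an $H$-selfadjoint $B$ there is an invertible $S\in\mathbb{H}^{n\times n}$ such that $S^{-1}BS=J_{k_1}(\lambda_1)\oplus\cdots\oplus J_{k_\alpha}(\lambda_\alpha)\oplus\bigoplus_{i=\alpha+1}^{\beta}\big(J_{k_i}(\lambda_i)\oplus J_{k_i}(\bar\lambda_i)\big)$ with $\lambda_1,\ldots,\lambda_\alpha$ real and $\lambda_{\alpha+1},\ldots,\lambda_\beta$ complex with positive imaginary part, and $S^*HS=\eta_1Q_{k_1}\oplus\cdots\oplus\eta_\alpha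 Q_{k_\alpha}\oplus Q_{2k_{\alpha+1}}\oplus\cdots\oplus Q_{2k_\beta}$ with $\eta_i=\pm1$; this form is unique up to permutation of blocks. The columns of $S$ form the basis ''producing the canonical form'', with the columns belonging to each block ordered as the block's rows. *)

(* Defs.v *)
From HB Require Import structures.
From mathcomp Require Import all_boot all_order all_algebra.
From mathcomp Require Import ring.
From mathcomp Require Import reals.
Set Implicit Arguments. Unset Strict Implicit. Unset Printing Implicit Defensive.
Import Order.TTheory GRing.Theory Num.Theory.
Local Open Scope ring_scope.

Section Quat.
Variable R : comNzRingType.
Record quat := Quat { qre : R; qi : R; qj : R; qk : R }.
Definition quat2tup (q : quat) := (qre q, qi q, qj q, qk q).
Definition tup2quat (t : R * R * R * R) := let: (a, b, c, d) := t in Quat a b c d.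
Lemma quat2tupK : cancel quat2tup tup2quat. Proof. by case. Qed.
HB.instance Definition _ := Equality.copy quat (can_type quat2tupK).
HB.instance Definition _ := Choice.copy quat (can_type quat2tupK).

Definition qzero := Quat 0 0 0 0.
Definition qone := Quat 1 0 0 0.
Definition qopp (p : quat) := Quat (- qre p) (- qi p) (- qj p) (- qk p).
Definition qadd (p q : quat) :=
  Quat (qre p + qre q) (qi p + qi q) (qj p + qj q) (qk p + qk q).
Definition qmul (p q : quat) :=
  Quat (qre p * qre q - qi p * qi q - qj p * qj q - qk p * qk q)
       (qre p * qi q + qi p * qre q + qj p * qk q - qk p * qj q)
       (qre p * qj q - qi p * qk q + qj p * qre q + qk p * qi q)
       (qre p * qk q + qi p * qj q - qj p * qi q + qk p * qre q).

Lemma qaddA : associative qadd.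
Proof. by move=> [? ? ? ?] [? ? ? ?] [? ? ? ?]; rewrite /qadd /= !addrA. Qed.
Lemma qaddC : commutative qadd.
Proof. by move=> [? ? ? ?] [? ? ? ?]; rewrite /qadd /= [X in Quat X]addrC [X in Quat _ X]addrC
  [X in Quat _ _ X]addrC [X in Quat _ _ _ X]addrC. Qed.
Lemma qadd0 : left_id qzero qadd.
Proof. by move=> [? ? ? ?]; rewrite /qadd /= !add0r. Qed.
Lemma qaddN : left_inverse qzero qopp qadd.
Proof. by move=> [? ? ? ?]; rewrite /qadd /= !addNr. Qed.
Lemma qmulA : associative qmul.
Proof. move=> [? ? ? ?] [? ? ? ?] [? ? ? ?]; rewrite /qmul /=; congr Quat; ring. Qed.
Lemma qmul1 : left_id qone qmul.
Proof. move=> [? ? ? ?]; rewrite /qmul /=; congr Quat; ring. Qed.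
Lemma qmulr1 : right_id qone qmul.
Proof. move=> [? ? ? ?]; rewrite /qmul /=; congr Quat; ring. Qed.
Lemma qmulDl : left_distributive qmul qadd.
Proof. move=> [? ? ? ?] [? ? ? ?] [? ? ? ?]; rewrite /qmul /qadd /=; congr Quat; ring. Qed.
Lemma qmulDr : right_distributive qmul qadd.
Proof. move=> [? ? ? ?] [? ? ? ?] [? ? ? ?]; rewrite /qmul /qadd /=; congr Quat; ring. Qed.
Lemma qone_neq0 : qone != qzero.
Proof. by apply/eqP => -[] /eqP; rewrite oner_eq0. Qed.

HB.instance Definition _ := GRing.isNzRing.Build quat
  qaddA qaddC qadd0 qaddN qmulA qmul1 qmulr1 qmulDl qmulDr qone_neq0.


Definition qconj (q : quat) := Quat (qre q) (- qi q) (- qj q) (- qk q).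
Definition qofR (r : R) : quat := Quat r 0 0 0.
Definition qofC (a b : R) : quat := Quat a b 0 0.
End Quat.

Arguments qofR {R}.
Arguments qofC {R}.

Definition adjq (R : comNzRingType) (m n : nat) (A : 'M[quat R]_(m, n)) : 'M[quat R]_(n, m) :=
  (map_mx (@qconj R) A)^T.

Definition H_polar_decomposition (R : comNzRingType) (n : nat)
  (H Hinv X : 'M[quat R]_n) : Prop :=
  exists U A : 'M[quat R]_n,
    adjq U *m H *m U = H /\ Hinv *m adjq A *m H = A /\ X = U *m A.

Section Canon.
Variable R : realType.
Local Notation Q := (quat R).

(* local (finite-size) blocks, as functions on nat indices *)
Definition jordanF (lam : Q) : nat -> nat -> Q :=
  fun p q => if p == q then lam else if q == p.+1 then 1 else 0.
Definition antidiagF (k : nat) : nat -> nat -> Q :=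
  fun p q => if (p + q == k.-1)%N then 1 else 0.
Definition dsumF (k : nat) (f g : nat -> nat -> Q) : nat -> nat -> Q :=
  fun p q => if (p < k)%N then (if (q < k)%N then f p q else 0)
             else if (q < k)%N then 0 else g (p - k)%N (q - k)%N.
Definition scaleF (c : Q) (f : nat -> nat -> Q) : nat -> nat -> Q :=
  fun p q => c * f p q.
Definition zeroF : nat -> nat -> Q := fun _ _ => 0.
Definition signq (eta : bool) : Q := if eta then -1 else 1.
Definition unitV (p : nat) : nat -> Q := fun i => if i == p then 1 else 0.

Inductive cgroup :=
  (* (J_k(lam), eta Q_k), lam > 0 real *)
  | GPos of nat & R & bool
  (* (J_k(lam) (+) J_k(conj lam), Q_2k), lam = a + b i, b > 0 *)
  | GCpx of nat & R & R
  (* (J_k(lam) (+) J_k(lam), Q_k (+) -Q_k), lam < 0 *)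
  | GNeg of nat & R
  (* (J_{k+1}(0) (+) J_k(0), eta Q_{k+1} (+) eta Q_k), k >= 0 *)
  | GZodd of nat & bool
  (* (J_k(0) (+) J_k(0), Q_k (+) -Q_k), k >= 1 *)
  | GZeven of nat.

Definition cg_valid (g : cgroup) : bool :=
  match g with
  | GPos k lam _ => (0 < k)%N && (0 < lam)
  | GCpx k _ b => (0 < k)%N && (0 < b)
  | GNeg k lam => (0 < k)%N && (lam < 0)
  | GZodd _ _ => true
  | GZeven k => (0 < k)%N
  end.

Definition cg_size (g : cgroup) : nat :=
  match g with
  | GPos k _ _ => k
  | GCpx k _ _ => k + k
  | GNeg k _ => k + k
  | GZodd k _ => k.+1 + k
  | GZeven k => k + k
  end.

Definition cg_B (g : cgroup) : nat -> nat -> Q :=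
  match g with
  | GPos k lam _ => jordanF (qofR lam)
  | GCpx k a b => dsumF k (jordanF (qofC a b)) (jordanF (qofC a (- b)))
  | GNeg k lam => dsumF k (jordanF (qofR lam)) (jordanF (qofR lam))
  | GZodd k _ => dsumF k.+1 (jordanF 0) (jordanF 0)
  | GZeven k => dsumF k (jordanF 0) (jordanF 0)
  end.

Definition cg_H (g : cgroup) : nat -> nat -> Q :=
  match g with
  | GPos k _ eta => scaleF (signq eta) (antidiagF k)
  | GCpx k _ _ => antidiagF (k + k)
  | GNeg k _ => dsumF k (antidiagF k) (scaleF (-1) (antidiagF k))
  | GZodd k eta => dsumF k.+1 (scaleF (signq eta) (antidiagF k.+1))
                              (scaleF (signq eta) (antidiagF k))
  | GZeven k => dsumF k (antidiagF k) (scaleF (-1) (antidiagF k))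
  end.

(* local coordinate vectors of the generators of Ker X contributed by a group:
   ZOdd with k = 0 (the blocks J_1(0) collected in B_0): e_{0,j};
   ZOdd with k >= 1 (odd order): e_{i,1};  ZEven k (order 2k): e_{i,1} + e_{i,k+1}. *)
Definition cg_ker (g : cgroup) : seq (nat -> Q) :=
  match g with
  | GZodd _ _ => [:: unitV 0]
  | GZeven k => [:: fun p => unitV 0 p + unitV k p]
  | _ => [::]
  end.

Fixpoint canB (s : seq cgroup) : nat -> nat -> Q :=
  if s is g :: s' then dsumF (cg_size g) (cg_B g) (canB s') else zeroF.
Fixpoint canH (s : seq cgroup) : nat -> nat -> Q :=
  if s is g :: s' then dsumF (cg_size g) (cg_H g) (canH s') else zeroF.
Definition shiftV (off : nat) (v : nat -> Q) : nat -> Q :=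
  fun i => if (off <= i)%N then v (i - off)%N else 0.
Fixpoint canKer (s : seq cgroup) : seq (nat -> Q) :=
  if s is g :: s' then
    cg_ker g ++ map (shiftV (cg_size g)) (canKer s')
  else [::].
Definition can_size (s : seq cgroup) : nat := sumn (map cg_size s).

Definition colsF (n : nat) (vs : seq (nat -> Q)) : 'M[Q]_(n, size vs) :=
  \matrix_(i < n, j < size vs) nth (fun _ => 0) vs j i.
End Canon.

(* Main.v *)
(** If [X = U A] is an [H]-polar decomposition then [A^2 = B] and [Ker A = Ker X]; conversely, an
    [H]-selfadjoint [A] with these two properties satisfies [X^* H X = A^* H A] and [Ker X = Ker A],
    so Witt's extension theorem yields an [H]-unitary [U] with [X = U A].  Hence everything is
    about [H]-selfadjoint square roots [A] of [B] and their kernels.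

    Given the canonical form, each group of blocks has an explicit square root: a Toeplitz matrix
    [s(N)] with [s(x)^2 = lambda + x] up to high order, or a shuffle of shifts at eigenvalue 0.

    Given [A], one splits off an [A]-invariant nondegenerate subspace at a time.  Let [m] be the
    minimal complex polynomial of [A] (acting on the right through [C] inside the quaternions),
    [lam] a root of multiplicity [k] and [r = m / (X - lam)^k].  The forms [f |-> [w, f(A) w]]
    do not all vanish on [r^2 t^(k-1)] ([r r^* t^(k-1)] for real [lam]), where [t = X^2 - lam^2]
    ([t = X] if [lam = 0]).  Multiplying [v = r(A) w] by a square root of a power series in [t]
    turns [v], [t v], [t^2 v], ... into canonical chains of [A^2]. *)
Require Import Defs.
From HB Require Import structures.
From mathcomp Require Import all_boot all_order all_algebra.
From mathcomp Require Import ring lra zify.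
From mathcomp Require Import boolp reals complex.
Set Implicit Arguments. Unset Strict Implicit. Unset Printing Implicit Defensive.
Import Order.TTheory GRing.Theory Num.Theory.
Local Open Scope ring_scope.

(** Noncommutativity is avoided by staying inside one cyclic subspace: the moments [[w, A^i w]] are
    selfadjoint quaternions, hence real, so all Gram entries between vectors [f(A) w] lie in C and
    the search for a block becomes commutative algebra of polynomials. The choice between [r r^*]
    and [r^2] follows the shape of the block. A chain generated by [h(A) w] has Gram entries built
    from [h^* h]. For non-real [lam] the conjugate is also a root of [m], with the same
    multiplicity, and [h^* h] annihilates [A]; such a chain is isotropic and has to be paired with
    the chain of [h^*], where the entries are built from [h h]. Conjugating [lam] makes the
    imaginary part of [lam^2] nonnegative. Purely imaginary [lam] is what produces negative
    eigenvalues of [B]; its isotropic pair, rotated by 45 degrees, gives the opposite signs in (i).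
    At [lam = 0] a chain of [A] falls apart into its vectors of even and of odd index, which are two
    chains of [A^2]. The parity of the length of the chain decides which of the two shapes in (ii)
    appears. *)

(** * Truncated square roots of power series *)

Lemma polyX_split (F : fieldType) (f : {poly F}) : exists q : {poly F}, f = q * 'X + (f`_0)%:P.
Proof.
elim/poly_ind: f => [|q c _]; first by exists 0; rewrite coef0 mul0r add0r.
by exists q; rewrite coefD coefMX coefC eqxx add0r.
Qed.

(** Hensel lifting, one coefficient of [g] at a time. The target [e] is left free because over the
    reals only the sign of the constant term can be reached. *)
Lemma sqrt_series (F : fieldType) (c : {poly F}) (g0 e : F) k :
  2 != 0 :> F -> g0 != 0 -> c`_0 != 0 -> g0 ^+ 2 * c`_0 = e ->
  exists g q : {poly F}, g`_0 = g0 /\ g ^+ 2 * c = e%:P + q * 'X^(k.+1).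
Proof.
move=> F2 g00 c0 ge; elim: k => [|k [g [q [gg0 gE]]]].
  have [q qE] := polyX_split (g0%:P ^+ 2 * c).
  exists g0%:P, q; rewrite coefC eqxx; split=> //.
  by rewrite qE -polyC_exp coefCM ge addrC expr1.
have [q' q'E] := polyX_split q.
have [c' c'E] := polyX_split (g * c).
(* Adding [a X^(k+1)] to [g] changes the coefficient of [X^(k+1)] in [g^2 c] by [2 a g0 c_0]; this
   [a] cancels it. *)
pose a := - q`_0 / (2 * (g0 * c`_0)).
exists (g + a%:P * 'X^(k.+1)), (q' + 2%:R * a%:P * c' + a%:P ^+ 2 * c * 'X^k).
rewrite coefD coefCM coefXn /= mulr0 addr0; split=> //.
have -> : (g + a%:P * 'X^(k.+1)) ^+ 2 * c =
   g ^+ 2 * c + (2%:R * a%:P * (g * c) + a%:P ^+ 2 * c * 'X^(k.+1)) * 'X^(k.+1) by ring.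
rewrite gE c'E {1}q'E coef0M gg0.
have -> : q`_0 = - (2 * a * (g0 * c`_0)).
  by rewrite /a mulrAC mulrCA divff ?mulr1 ?opprK // !mulf_neq0.
rewrite (exprS _ k.+1) (exprS _ k) polyCN !polyCM.
by rewrite [(2 : F)%:P]polyCMn; ring.
Qed.

Lemma sum_widen (V : nmodType) (G : nat -> V) a N : (a <= N)%N ->
  (forall l, (a <= l)%N -> G l = 0) -> \sum_(l < a) G l = \sum_(l < N) G l.
Proof.
move=> aN G0; rewrite (big_ord_widen N G aN) big_mkcond; apply: eq_bigr => l _.
by case: ltnP => // /G0 ->.
Qed.

(* Replacing a generator [v] of a chain with moments [c] by [g v] changes the moments into the
   left-hand side below. *)
Lemma hankel_sqrt (F : fieldType) (c : nat -> F) K (g0 e : F) :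
  2 != 0 :> F -> g0 != 0 -> c K != 0 -> g0 ^+ 2 * c K = e ->
  (forall j, (K < j)%N -> c j = 0) ->
  exists g : {poly F}, forall j,
    \sum_(l < size (g * g)) (g * g)`_l * c (l + j)%N = if j == K then e else 0.
Proof.
(* Reversing the moments turns the Hankel sum with shift [j] into the coefficient of degree [K - j]
   of the product [g^2 Cp]. *)
move=> F2 g00 cK ge c0; pose Cp := \poly_(i < K.+1) c (K - i)%N.
have Cp0 : Cp`_0 = c K by rewrite coef_poly subn0.
have [||g [q [_ gE]]] := @sqrt_series F Cp g0 e K F2 g00; rewrite ?Cp0 //.
exists g => j; case: (ltnP K j) => [Kj|jK].
  rewrite gtn_eqF // big1 // => l _; rewrite c0 ?mulr0 //.
  exact: leq_trans Kj (leq_addl _ _).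
pose G l := (g * g)`_l * c (l + j)%N; pose N := maxn (size (g * g)) (K - j).+1.
have -> : \sum_(l < size (g * g)) (g * g)`_l * c (l + j)%N = \sum_(l < N) G l.
  apply: (@sum_widen _ G); first exact: leq_maxl.
  by move=> l gl; rewrite /G nth_default // mul0r.
rewrite -(@sum_widen _ G (K - j).+1) ?leq_maxr //; last first.
  by move=> l Kl; rewrite /G c0 ?mulr0 //; lia.
have := congr1 (fun p : {poly F} => p`_(K - j)) gE.
rewrite coefD coefC coefMXn ltnS leq_subr addr0 subn_eq0 expr2 coefM.
have -> : (K <= j)%N = (j == K) by lia.
move=> <-; apply: eq_bigr => l _; rewrite /G coef_poly ifT; last by have := ltn_ord l; lia.
by congr (_ * c _); have := ltn_ord l; lia.
Qed.

(** One inverse square root [g] of [c] serves twice: [s = g c] is a square root of [c] and [u = g^2]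
    is an inverse of [c]. *)
Lemma sqrt_trunc (F : fieldType) (c : {poly F}) (g0 : F) k :
  2 != 0 :> F -> g0 ^+ 2 * c`_0 = 1 ->
  exists s u q q' : {poly F}, [/\ s`_0 = g0 * c`_0, s ^+ 2 = c + q * 'X^(k.+1) &
    u * c = 1 + q' * 'X^(k.+1)].
Proof.
move=> F2 gl; have l0 : c`_0 != 0 by apply: contra_eq_neq gl => ->; rewrite mulr0 eq_sym oner_eq0.
have g00 : g0 != 0 by apply: contra_eq_neq gl => ->; rewrite expr0n mul0r eq_sym oner_eq0.
have [g [q [gg0 gE]]] := @sqrt_series F c g0 1 k F2 g00 l0 gl.
exists (g * c), (g ^+ 2), (q * c), q; split=> //; first by rewrite coef0M gg0.
rewrite exprMn [c ^+ 2]expr2 mulrA gE polyC1; ring.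
Qed.

(* [D] stands for the quaternions.  The interface keeps their multiplication table abstract: only
   division, the involution, the embedded complex numbers (real ones central), and a real trace
   and real coordinates (both only for finiteness of dimension) matter. *)
Section Skew.
Variables (R : realType) (D : nzRingType) (conj : {additive D -> D}).
Variables (iota : {rmorphism R[i] -> D}) (re : {additive D -> R}).
Variables (coord : {additive D -> 'rV[R]_4}).
Hypotheses (conjM : forall p q, conj (p * q) = conj q * conj p).
Hypotheses (conjK : involutive conj).
Hypotheses (divD : forall q : D, q != 0 -> {q' : D | q * q' = 1 & q' * q = 1}).
Hypotheses (iota_conj : forall z, conj (iota z) = iota (conjc z)).
Hypotheses (iotaC : forall (x : R) q, iota x%:C%C * q = q * iota x%:C%C).
Hypotheses (conj_fix : forall q, conj q = q -> q = iota (re q)%:C%C).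
Hypotheses (reC : forall p q, re (p * q) = re (q * p)) (re1 : re 1 = 1).
Hypotheses (coord_inj : forall q, coord q = 0 -> q = 0).
Hypotheses (coordZ : forall (x : R) q, coord (iota x%:C%C * q) = x *: coord q).

(** * Adjoints and linear algebra over a division ring *)

Definition adj m n (A : 'M[D]_(m, n)) : 'M[D]_(n, m) := (map_mx conj A)^T.

Lemma conj1 : conj 1 = 1.
Proof. by rewrite -[LHS]mul1r -{1}(conjK 1) -conjM mul1r conjK. Qed.

Lemma adjE m n (A : 'M[D]_(m, n)) i j : adj A i j = conj (A j i).
Proof. by rewrite /adj mxE mxE. Qed.

Lemma adjM m n p (A : 'M[D]_(m, n)) (B : 'M[D]_(n, p)) :
  adj (A *m B) = adj B *m adj A.
Proof.
apply/matrixP=> i j; rewrite !mxE raddf_sum; apply: eq_bigr => l _.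
by rewrite !mxE /= conjM.
Qed.

Lemma adjK m n (A : 'M[D]_(m, n)) : adj (adj A) = A.
Proof. by apply/matrixP=> i j; rewrite !mxE conjK. Qed.

Lemma adjB m n : {morph @adj m n : A B / A - B}.
Proof. by move=> A B; apply/matrixP=> i j; rewrite !mxE raddfB. Qed.
HB.instance Definition _ m n :=
  GRing.isZmodMorphism.Build 'M[D]_(m, n) 'M[D]_(n, m) (@adj m n) (@adjB m n).

Lemma adj1 n : adj 1%:M = 1%:M :> 'M[D]_n.
Proof.
by apply/matrixP=> i j; rewrite !mxE eq_sym; case: (i == j); rewrite ?conj1 ?raddf0.
Qed.

Lemma adj_row_mx m n1 n2 (A : 'M[D]_(m, n1)) (B : 'M[D]_(m, n2)) :
  adj (row_mx A B) = col_mx (adj A) (adj B).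
Proof. by rewrite /adj map_row_mx tr_row_mx. Qed.

Lemma adj_block_mx m1 m2 n1 n2 (A : 'M[D]_(m1, n1)) (B : 'M[D]_(m1, n2))
    (A3 : 'M[D]_(m2, n1)) (A4 : 'M[D]_(m2, n2)) :
  adj (block_mx A B A3 A4) = block_mx (adj A) (adj A3) (adj B) (adj A4).
Proof. by rewrite /adj map_block_mx tr_block_mx. Qed.

Lemma mul_matrix_col m n (A B : 'M[D]_(m, n)) :
  (forall v : 'cV[D]_n, A *m v = B *m v) -> A = B.
Proof.
move=> AB; apply/matrixP=> i j.
have /colP/(_ i) := AB (delta_mx j 0).
by rewrite -!colE !mxE.
Qed.

Lemma neq0_mulmx_col n (y : 'rV[D]_n) : y != 0 -> {c : 'cV[D]_n | y *m c = 1%:M}.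
Proof.
move=> y0; have /existsP/sigW[j yj0] : [exists j, y 0 j != 0].
  apply: contraNT y0 => /existsPn yj; apply/eqP/rowP => j.
  by have /negPn/eqP-> := yj j; rewrite mxE.
have [c jc _] := divD yj0; exists (c *: delta_mx j 0).
apply/matrixP=> a b; rewrite !ord1 !mxE (bigD1 j) //= big1 ?addr0 => [|l lj].
  by rewrite !mxE !eqxx mulr1.
by rewrite !mxE (negPf lj) /= !mulr0.
Qed.

(** This plays the role of rank over [D]: injectivity and surjectivity are carried by explicit
    one-sided inverses. The induction adds one row of [Z] at a time. *)
Lemma full_rank_factor m n (Z : 'M[D]_(m, n)) :
  exists r (F : 'M[D]_(m, r)) (F' : 'M[D]_(r, n)) (L : 'M[D]_(r, m)) (K : 'M[D]_(n, r)),
    [/\ Z = F *m F', L *m F = 1%:M & F' *m K = 1%:M].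
Proof.
elim: m Z => [|m IHm] Z.
  exists 0%N, 0, 0, 0, 0; split; first by apply/matrixP=> -[].
    by apply/matrixP=> -[].
  by apply/matrixP=> -[].
rewrite -[m.+1]/(1 + m)%N in Z *; rewrite -[Z]vsubmxK; move: (usubmx Z) (dsubmx Z) => z {}Z.
have [r [F [F' [L [K [-> LF FK]]]]]] := IHm Z.
(* [y] is the new row with its part along the rows of [F'] removed; it enlarges the factorisation
   exactly when it is nonzero. *)
pose y := z *m (1%:M - K *m F').
have zE : z = y + z *m K *m F' by rewrite /y mulmxBr mulmx1 mulmxA subrK.
have yK : y *m K = 0 by rewrite /y -mulmxA mulmxBl mul1mx -mulmxA FK mulmx1 subrr mulmx0.
have [y0 | /neq0_mulmx_col [c yc]] := eqVneq y 0.
  exists r, (col_mx (z *m K) F), F', (row_mx 0 L), K; split=> //.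
    by rewrite mul_col_mx {1}zE y0 add0r.
  by rewrite mul_row_col mul0mx add0r.
(* A right inverse of [y] corrected so that [F' c' = 0]. *)
pose c' := (1%:M - K *m F') *m c.
exists (1 + r)%N, (block_mx 1%:M (z *m K) 0 F), (col_mx y F'),
  (block_mx 1%:M (- (z *m K *m L)) 0 L), (row_mx c' K); split.
- by rewrite mul_block_col mul1mx mul0mx add0r -zE.
- by rewrite mulmx_block !mul1mx !mul0mx !mulmx0 ?add0r ?addr0 mulNmx -!mulmxA LF mulmx1
    subrr -scalar_mx_block.
rewrite mul_col_row yK FK /c' mulmxA mulmxBr mulmx1 mulmxA yK mul0mx subr0 yc.
by rewrite mulmxA mulmxBr mulmx1 mulmxA FK mul1mx subrr mul0mx -scalar_mx_block.
Qed.

Lemma re_mxtraceC m n (A : 'M[D]_(m, n)) (B : 'M[D]_(n, m)) :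
  re (\tr (A *m B)) = re (\tr (B *m A)).
Proof.
rewrite /mxtrace !raddf_sum /=.
under eq_bigr do rewrite mxE raddf_sum.
under [RHS]eq_bigr do rewrite mxE raddf_sum.
rewrite exchange_big; apply: eq_bigr => i _; apply: eq_bigr => j _ /=.
exact: reC.
Qed.

(** The trace is cyclic only after [re], since [D] is not commutative; the real trace of an identity
    matrix recovers its size. *)
Lemma invmx_size m n (A : 'M[D]_(m, n)) (B : 'M[D]_(n, m)) :
  A *m B = 1%:M -> B *m A = 1%:M -> m = n.
Proof.
move=> AB BA; have := re_mxtraceC A B; rewrite AB BA !mxtrace1.
rewrite !raddfMn /= re1 => /eqP; rewrite eqr_nat => /eqP //.
Qed.

(** [E P] is idempotent, and a full-rank factorisation [F F'] of the complementary idempotent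
    provides a basis of the kernel of [P]. *)
Lemma complement d n (P : 'M[D]_(d, n)) (E : 'M[D]_(n, d)) : P *m E = 1%:M ->
  exists n' (F : 'M[D]_(n, n')) (F' : 'M[D]_(n', n)),
    [/\ n = (d + n')%N, P *m F = 0, F' *m E = 0, F' *m F = 1%:M &
        E *m P + F *m F' = 1%:M].
Proof.
move=> PE; have [n' [F [F' [L [K [Zdef LF FK]]]]]] := full_rank_factor (1%:M - E *m P).
have PF : P *m F = 0.
  rewrite -[F]mulmx1 -FK (mulmxA F) -Zdef mulmxA mulmxBr mulmx1 mulmxA PE mul1mx.
  by rewrite subrr mul0mx.
have FE : F' *m E = 0.
  rewrite -[F']mul1mx -LF -(mulmxA L) -Zdef -mulmxA mulmxBl mul1mx -(mulmxA E) PE mulmx1.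
  by rewrite subrr mulmx0.
have F'F : F' *m F = 1%:M.
  have : L *m (1%:M - E *m P) *m F = L *m F.
    by rewrite -mulmxA mulmxBl mul1mx -(mulmxA E) PF mulmx0 subr0.
  by rewrite Zdef !mulmxA LF mul1mx.
have EPFF : E *m P + F *m F' = 1%:M by rewrite -Zdef addrC subrK.
exists n', F, F'; split=> //.
apply: (@invmx_size _ _ (row_mx E F) (col_mx P F')); first by rewrite mul_row_col.
by rewrite mul_col_row PE PF FE F'F -scalar_mx_block.
Qed.

Lemma inj_left_inverse n r (Y : 'M[D]_(n, r)) :
  (forall c : 'cV[D]_r, Y *m c = 0 -> c = 0) -> exists L, L *m Y = 1%:M.
Proof.
move=> Yinj; have [r' [F [F' [L [K [YE LF FK]]]]]] := full_rank_factor Y.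
exists (K *m L); rewrite {1}YE -mulmxA (mulmxA L) LF mul1mx.
apply/esym/eqP; rewrite -subr_eq0; apply/eqP; apply: mul_matrix_col => c.
rewrite mul0mx; apply: Yinj.
by rewrite YE mulmxA -(mulmxA F) mulmxBr mulmx1 mulmxA FK mul1mx subrr mulmx0 mul0mx.
Qed.

Definition herm n (H : 'M[D]_n) (u v : 'cV[D]_n) : D := (adj u *m H *m v) 0 0.

Lemma hermE n (H : 'M[D]_n) u v : adj u *m H *m v = (herm H u v)%:M.
Proof. by rewrite [LHS]mx11_scalar. Qed.

(** * Witt's extension theorem *)

Section Witt.
Variables (n : nat) (H Hinv : 'M[D]_n).
Hypotheses (Hadj : adj H = H) (HHinv : H *m Hinv = 1%:M) (HinvH : Hinv *m H = 1%:M).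

Lemma hermC u v : conj (herm H u v) = herm H v u.
Proof.
by rewrite /herm -adjE !adjM adjK Hadj mulmxA.
Qed.

Lemma hermDl u u' v : herm H (u + u') v = herm H u v + herm H u' v.
Proof. by rewrite /herm raddfD /= !mulmxDl [LHS]mxE. Qed.

Lemma hermDr u v v' : herm H u (v + v') = herm H u v + herm H u v'.
Proof. by rewrite /herm mulmxDr [LHS]mxE. Qed.

Lemma hermBr u v v' : herm H u (v - v') = herm H u v - herm H u v'.
Proof. by rewrite /herm mulmxBr [LHS]mxE [X in _ + X]mxE. Qed.

Lemma hermBl u u' v : herm H (u - u') v = herm H u v - herm H u' v.
Proof. by rewrite /herm raddfB /= !mulmxBl [LHS]mxE [X in _ + X]mxE. Qed.

Lemma hermZr u v q : herm H u (v *m q%:M) = herm H u v * q.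
Proof. by rewrite /herm mulmxA hermE -scalar_mxM [LHS]mxE [X in _ = X * _]mxE eqxx. Qed.

(* Quasi-reflections [z - a c^-1 [a, z]] are isometries as soon as [c + c^* = [a, a]]. *)
Lemma quasi_reflection (a : 'cV[D]_n) (c d : D) :
  c * d = 1 -> d * c = 1 -> c + conj c = herm H a a ->
  let U := 1%:M - a *m d%:M *m adj a *m H in adj U *m H *m U = H.
Proof.
move=> cd dc ca U.
have adj_scal (q : D) : adj (q%:M : 'M_1) = (conj q)%:M.
  by apply/matrixP=> i j; rewrite !mxE !ord1 eqxx.
have Ustar : adj U = 1%:M - H *m a *m (conj d)%:M *m adj a.
  by rewrite /U raddfB /= adj1 !adjM adjK Hadj adj_scal !mulmxA.
have key : conj d + d = conj d * herm H a a * d.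
  by rewrite -ca mulrDr mulrDl -mulrA cd mulr1 -conjM cd conj1 mul1r.
pose T q := H *m a *m q%:M *m adj a *m H.
have TD : T (conj d + d) = T (conj d) + T d by rewrite /T raddfD /= mulmxDr !mulmxDl.
have -> : adj U *m H = H - T (conj d) by rewrite Ustar mulmxBl mul1mx.
rewrite /U mulmxBr mulmx1 mulmxBl.
have -> : T (conj d) *m (a *m d%:M *m adj a *m H) = T (conj d) + T d.
  by rewrite -TD key /T !scalar_mxM -hermE !mulmxA.
have -> : H *m (a *m d%:M *m adj a *m H) = T d by rewrite /T !mulmxA.
by rewrite opprB addrK subrK.
Qed.

Lemma quasi_reflection_exists (a : 'cV[D]_n) (c : D) : c != 0 ->
  c + conj c = herm H a a ->
  exists U d, [/\ adj U *m H *m U = H, c * d = 1, d * c = 1 &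
    forall m (Z : 'M[D]_(n, m)), U *m Z = Z - a *m d%:M *m (adj a *m H *m Z)].
Proof.
move=> /divD[d cd dc] ca; exists (1%:M - a *m d%:M *m adj a *m H), d.
split=> // [|m Z]; first exact: (quasi_reflection cd dc ca).
by rewrite mulmxBl mul1mx !mulmxA.
Qed.

(** The quasi-reflection with [a = x - y] and [c = [a, x]]. Equal Gram data give [c + c^* = [a, a]]
    and make [a] orthogonal to [W], so [W] is fixed, while [x] goes to [x - a = y]. *)
Lemma witt_step_reflect m (W : 'M[D]_(n, m)) (x y : 'cV[D]_n) :
  adj W *m H *m x = adj W *m H *m y -> herm H x x = herm H y y ->
  herm H (x - y) x != 0 ->
  exists V, [/\ adj V *m H *m V = H, V *m W = W & V *m x = y].
Proof.
move=> Wxy xy c0.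
have [|V [d [VH cd dc VE]]] := quasi_reflection_exists (a := x - y) c0.
  by rewrite hermC !hermBl !hermBr xy opprB addrC.
have aW : adj (x - y) *m H *m W = 0.
  have : adj W *m H *m (x - y) = 0 by rewrite mulmxBr Wxy subrr.
  by move/(congr1 (@adj _ _)); rewrite !adjM adjK Hadj mulmxA raddf0.
exists V; split=> //; first by rewrite VE aW mulmx0 subr0.
by rewrite VE hermE -mulmxA -scalar_mxM dc mulmx1 opprB addrC subrK.
Qed.

Lemma qmulf_neq0 (p q : D) : p != 0 -> q != 0 -> p * q != 0.
Proof.
move=> /divD[p' _ p'p] q0; apply: contra_neq q0 => pq0.
by rewrite -[q]mul1r -p'p -mulrA pq0 mulr0.
Qed.

Lemma isometry_mul U p q (Y : 'M[D]_(n, p)) (Z : 'M[D]_(n, q)) :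
  adj U *m H *m U = H -> adj (U *m Y) *m H *m (U *m Z) = adj Y *m H *m Z.
Proof. by move=> UH; rewrite adjM !mulmxA -!(mulmxA (adj Y)) UH. Qed.

(* If the quasi-reflection along [x - y] is singular, first move [x] by another one. *)
Lemma witt_step m (W : 'M[D]_(n, m)) (x y : 'cV[D]_n) (lx ly : 'rV[D]_n) :
  adj W *m H *m x = adj W *m H *m y -> herm H x x = herm H y y ->
  lx *m x = 1%:M -> lx *m W = 0 -> ly *m y = 1%:M -> ly *m W = 0 ->
  exists V, [/\ adj V *m H *m V = H, V *m W = W & V *m x = y].
Proof.
move=> Wxy xy lxx lxW lyy lyW.
have [c0|] := eqVneq (herm H (x - y) x) 0; last exact: witt_step_reflect.
(* One of [lx], [ly] and [lx + ly] is nonzero at both [x] and [y]. The vector representing it under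
   [H] is orthogonal to [W] but not to [x] or [y]. *)
have [l [lW lx0 ly0]] : exists l : 'rV[D]_n, [/\ l *m W = 0, l *m x != 0 & l *m y != 0].
  have n0 : 1%:M != 0 :> 'M[D]_1 by apply/eqP => /matrixP/(_ 0 0)/eqP; rewrite !mxE oner_eq0.
  have [lxy|] := eqVneq (lx *m y) 0; last by exists lx; rewrite lxx.
  have [lyx|] := eqVneq (ly *m x) 0; last by exists ly; rewrite lyy.
  exists (lx + ly); rewrite !mulmxDl lxW lyW addr0 lxx lyy lxy lyx addr0 add0r.
  by split.
pose a := Hinv *m adj l.
have aH : adj a *m H = l.
  by rewrite /a adjM adjK -mulmxA -[X in _ *m (_ *m X)]Hadj -adjM HHinv adj1 mulmx1.
(* The real part is the half of [[a, a]] that an isometry requires; the imaginary part 1 keeps [c1]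
   nonzero even if [a] is isotropic. *)
pose c1 := iota (Complex (re (herm H a a) / 2) 1).
have [||U [d [UH cd dc UE]]] := @quasi_reflection_exists a c1.
- by rewrite fmorph_eq0; apply/eqP => -[_ /eqP]; rewrite oner_eq0.
- rewrite [RHS](conj_fix (hermC a a)) iota_conj -rmorphD; congr (iota _).
  by congr Complex; rewrite /= ?subrr // -splitr.
have UW : U *m W = W by rewrite UE aH lW mulmx0 subr0.
have Ux : U *m x = x - a *m (d * herm H a x)%:M by rewrite UE hermE -mulmxA -scalar_mxM.
have fold_H p q (Y : 'M_(n, p)) (Z : 'M_(n, q)) := isometry_mul Y Z UH.
have ne0 (z : 'cV[D]_n) : l *m z != 0 -> herm H a z != 0.
  by apply: contra_neq => az; rewrite -aH hermE az raddf0.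
have d0 : d != 0 by apply: contra_eq_neq dc => ->; rewrite mul0r eq_sym oner_eq0.
have [|||V [VH VW Vx]] := @witt_step_reflect _ W (U *m x) y.
- by rewrite -{1}UW fold_H.
- by rewrite /herm fold_H.
(* The move adds to the vanishing [[x - y, x]] a product of three nonzero factors, so the second
   quasi-reflection is regular. *)
- have -> : herm H (U *m x - y) (U *m x) = herm H (x - y) x + herm H y a * (d * herm H a x).
    by rewrite !hermBl {1}/herm fold_H Ux hermBr hermZr opprB addrA addrAC.
  rewrite c0 add0r qmulf_neq0 // ?qmulf_neq0 ?ne0 //.
  rewrite -hermC; apply: contra_neq (ne0 _ ly0) => ay.
  by rewrite -[LHS]conjK ay raddf0.
by exists (V *m U); rewrite isometry_mul // -!(mulmxA V) UW Vx VW.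
Qed.

(** Induction on the columns: an isometry carrying the last [r] columns is corrected on the first
    one by [witt_step], which fixes the others. The left inverses express linear independence. *)
Lemma witt_extension r (Y1 Y2 : 'M[D]_(n, r)) L1 L2 :
  L1 *m Y1 = 1%:M -> L2 *m Y2 = 1%:M ->
  adj Y1 *m H *m Y1 = adj Y2 *m H *m Y2 ->
  exists U, adj U *m H *m U = H /\ U *m Y1 = Y2.
Proof.
elim: r Y1 Y2 L1 L2 => [|r IHr] Y1 Y2 L1 L2.
  by exists 1%:M; split; [rewrite adj1 mul1mx mulmx1 | apply/matrixP=> i []].
rewrite -[r.+1]/(1 + r)%N in Y1 Y2 L1 L2 *.
rewrite -[Y1]hsubmxK -[Y2]hsubmxK -[L1]vsubmxK -[L2]vsubmxK.
move: (lsubmx Y1) (rsubmx Y1) (lsubmx Y2) (rsubmx Y2) => x1 W1 x2 W2.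
move: (usubmx L1) (dsubmx L1) (usubmx L2) (dsubmx L2) => l1 K1 l2 K2.
rewrite !mul_col_row !(@scalar_mx_block _ 1 r) => /eq_block_mx[l1x l1W _ KW1].
move=> /eq_block_mx[l2x l2W _ KW2].
rewrite !adj_row_mx ![col_mx _ _ *m H]mul_col_mx !mul_col_row => /eq_block_mx[xx xW Wx WW].
have [U [UH UW]] := IHr _ _ _ _ KW1 KW2 WW.
pose U' := Hinv *m adj U *m H.
have UU : U' *m U = 1%:M by rewrite /U' -!mulmxA (mulmxA (adj U)) UH HinvH.
have fold_H p q (Y : 'M_(n, p)) (Z : 'M_(n, q)) := isometry_mul Y Z UH.
have [||||||V [VH VW Vx]] := @witt_step _ W2 (U *m x1) x2 (l1 *m U') l2.
- by rewrite -{1}UW fold_H.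
- by rewrite /herm fold_H xx.
- by rewrite mulmxA -(mulmxA l1) UU mulmx1.
- by rewrite -UW mulmxA -(mulmxA l1) UU mulmx1.
- by [].
- by [].
by exists (V *m U); rewrite isometry_mul // mul_mx_row -!(mulmxA V) UW VW Vx.
Qed.

(** Because the kernels agree, [X] factors through the surjective factor [F'] of [A = F F']. Witt's
    theorem is then applied to the injective matrices [F = A K] and [X K]. *)
Lemma unitary_factor_exists (X A : 'M[D]_n) :
  adj X *m H *m X = adj A *m H *m A ->
  (forall v : 'cV[D]_n, X *m v = 0 <-> A *m v = 0) ->
  exists U, adj U *m H *m U = H /\ X = U *m A.
Proof.
move=> XA kerXA; have [r [F [F' [L [K [AE LF FK]]]]]] := full_rank_factor A.
have XE : X = X *m K *m F'.
  apply: mul_matrix_col => v; apply/eqP; rewrite -subr_eq0 -mulmxBl; apply/eqP.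
  rewrite -[X in X - _]mulmx1 -mulmxA -mulmxBr -mulmxA; apply/kerXA.
  by rewrite AE mulmxA -(mulmxA F) mulmxBr mulmx1 mulmxA FK mul1mx subrr mulmx0 mul0mx.
have [|L' L'XK] := @inj_left_inverse _ _ (X *m K).
  move=> c; rewrite -mulmxA => /kerXA; rewrite AE mulmxA -(mulmxA F) FK mulmx1 => Fc.
  by rewrite -[c]mul1mx -LF -mulmxA Fc mulmx0.
have [|U [UH UF]] := witt_extension LF L'XK.
  have -> : F = A *m K by rewrite AE -mulmxA FK mulmx1.
  by rewrite !adjM !mulmxA -!(mulmxA (adj K)) -XA.
by exists U; rewrite AE mulmxA UF -XE.
Qed.

End Witt.

Local Notation C := R[i].
Local Notation cpoly f := (map_poly (@conjc R) f).
Local Notation RtoC := (real_complex R).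

(** * Square roots of the canonical blocks *)

(** This is [f(N)] for the nilpotent shift [N]. It is a ring morphism in [f] that kills [X^k], so
    identities between blocks reduce to identities between polynomials. *)
Definition toep k (f : {poly C}) : 'M[D]_k :=
  \matrix_(i, j) if (i <= j)%N then iota f`_(j - i) else 0.

Lemma toepM k f g : toep k f *m toep k g = toep k (f * g).
Proof.
apply/matrixP=> i j; rewrite mxE [RHS]mxE; case: leqP => [ij|ji]; last first.
  rewrite big1 // => l _; rewrite !mxE; case: leqP => [il|]; last by rewrite mul0r.
  by case: leqP => [lj|]; [have := leq_trans il lj; rewrite leqNgt ji | rewrite mulr0].
rewrite coefM rmorph_sum.
pose G l := iota f`_(l - i) * iota g`_(j - l).
transitivity (\sum_(l < k | (i <= l < j.+1)%N) G l).
  rewrite [RHS]big_mkcond; apply: eq_bigr => l _; rewrite !mxE ltnS /G.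
  by case: (leqP i l) => _ /=; case: (leqP l j) => _ /=; rewrite ?mul0r ?mulr0.
rewrite -(big_mkord (fun l => (i <= l < j.+1)%N) G) -(big_nat_widen 0 j.+1) //.
rewrite -(big_nat_widenl i 0 _ predT) // -[X in \sum_(X <= _ < _) _]add0n big_addn.
rewrite subSn // big_mkord.
by apply: eq_bigr => l _; rewrite /G addnK rmorphM subnDA subnAC.
Qed.

Lemma toepD k f g : toep k (f + g) = toep k f + toep k g.
Proof.
by apply/matrixP=> i j; rewrite !mxE coefD; case: leqP; rewrite ?addr0 ?rmorphD.
Qed.

Lemma toep_mulXn k f : toep k (f * 'X^k) = 0.
Proof.
apply/matrixP=> i j; rewrite !mxE coefMXn.
by rewrite (leq_ltn_trans (leq_subr _ _) (ltn_ord j)) rmorph0 if_same.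
Qed.

Lemma toep0 k : toep k 0 = 0.
Proof. by apply/matrixP=> i j; rewrite !mxE coef0 rmorph0 if_same. Qed.

Lemma toep1 k : toep k 1 = 1%:M.
Proof.
apply/matrixP=> i j; rewrite !mxE coef1 subn_eq0.
by rewrite -val_eqE eqn_leq /=; case: leqP => //= _; case: leqP; rewrite ?rmorph0 ?rmorph1.
Qed.

Lemma toepN k f : toep k (- f) = - toep k f.
Proof. by apply/matrixP=> i j; rewrite !mxE coefN rmorphN; case: leqP; rewrite ?oppr0. Qed.

(* The matrix [Q_k]. *)
Definition sip k : 'M[D]_k := \matrix_(i, j) if (i + j == k.-1)%N then 1 else 0.

Lemma mul_sip k m (M : 'M[D]_(k, m)) i j : (sip k *m M) i j = M (rev_ord i) j.
Proof.
rewrite mxE (bigD1 (rev_ord i)) //= big1 ?addr0 => [|l li]; rewrite !mxE.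
  by have := ltn_ord i; case: eqP => [_|]; rewrite ?mul1r //= => + ilt; lia.
case: eqP => [il|_]; rewrite ?mul0r //.
case/eqP: li; apply/val_inj => /=; have := ltn_ord i; lia.
Qed.

Lemma mul_sipr k m (M : 'M[D]_(m, k)) i j : (M *m sip k) i j = M i (rev_ord j).
Proof.
rewrite mxE (bigD1 (rev_ord j)) //= big1 ?addr0 => [|l lj]; rewrite !mxE.
  by have := ltn_ord j; case: eqP => [_|]; rewrite ?mulr1 //= => + jlt; lia.
case: eqP => [il|_]; rewrite ?mulr0 //.
case/eqP: lj; apply/val_inj => /=; have := ltn_ord j; lia.
Qed.

(** The flip by [Q_k] turns an upper Toeplitz matrix into its transpose. So [N] is selfadjoint for
    [Q_k], and the adjoint of [f(N)] only conjugates the coefficients. *)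
Lemma toep_sip k f : adj (toep k f) *m sip k = sip k *m toep k (cpoly f).
Proof.
apply/matrixP=> i j; rewrite mul_sip mul_sipr !mxE coef_map /=.
have := ltn_ord i; have := ltn_ord j => jk ik.
have -> : (k - j.+1 <= i)%N = (k - i.+1 <= j)%N by lia.
case: leqP => _; last by rewrite raddf0.
by rewrite iota_conj; congr (iota (conjc _`_ _)); lia.
Qed.

Lemma cpolyRtoC (f : {poly R}) : cpoly (map_poly RtoC f) = map_poly RtoC f.
Proof. by apply/polyP=> i; rewrite !coef_map /= /real_complex_def /= oppr0. Qed.

Lemma adj_sip k : adj (sip k) = sip k.
Proof.
by apply/matrixP=> i j; rewrite !mxE addnC; case: ifP; rewrite ?conj1 ?raddf0.
Qed.

Lemma sip_sip k : sip k *m sip k = 1%:M.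
Proof.
apply/matrixP=> i j; rewrite mul_sip !mxE -val_eqE /=.
have := ltn_ord i; have := ltn_ord j => jk ik.
have -> : (k - i.+1 + j == k.-1)%N = (i == j :> nat)%N by lia.
by case: eqP.
Qed.

Definition jordan k (c : C) := toep k ('X + c%:P).
Definition sgd (e : bool) : D := if e then -1 else 1.
Definition unit0 k : 'cV[D]_k := \col_i if i == 0 :> nat then 1 else 0.

(** [blkB], [blkH] and [blkK] recast [cg_B], [cg_H] and [cg_ker] as block matrices; [matrix_cg_B],
    [matrix_cg_H] and [colsF_cg_ker] identify them. *)
Definition blkB (g : cgroup R) : 'M[D]_(cg_size g) :=
  match g with
  | GPos k l _ => jordan k l%:C%C
  | GCpx k a b => block_mx (jordan k (Complex a b)) 0 0 (jordan k (Complex a (- b)))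
  | GNeg k l => block_mx (jordan k l%:C%C) 0 0 (jordan k l%:C%C)
  | GZodd k _ => block_mx (toep k.+1 'X) 0 0 (toep k 'X)
  | GZeven k => block_mx (toep k 'X) 0 0 (toep k 'X)
  end.

Definition blkH (g : cgroup R) : 'M[D]_(cg_size g) :=
  match g with
  | GPos k _ e => sgd e *: sip k
  | GCpx k a b => block_mx 0 (sip k) (sip k) 0
  | GNeg k l => block_mx (sip k) 0 0 (- sip k)
  | GZodd k e => block_mx (sgd e *: sip k.+1) 0 0 (sgd e *: sip k)
  | GZeven k => block_mx (sip k) 0 0 (- sip k)
  end.

Definition blkK (g : cgroup R) : 'M[D]_(cg_size g, size (cg_ker g)) :=
  match g with
  | GPos k l _ => 0
  | GCpx k a b => 0
  | GNeg k l => 0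
  | GZodd k e => col_mx (unit0 k.+1) 0
  | GZeven k => col_mx (unit0 k) (unit0 k)
  end.

Lemma sgd_sgd e : sgd e * sgd e = 1.
Proof. by case: e; rewrite /sgd ?mulrNN mulr1. Qed.

Lemma scalemx_sgdr e m n p (A : 'M[D]_(m, n)) (B : 'M[D]_(n, p)) :
  A *m (sgd e *: B) = sgd e *: (A *m B).
Proof. by case: e; rewrite /sgd ?scaleN1r ?mulmxN ?scale1r. Qed.

Lemma blkH_inv g : blkH g *m blkH g = 1%:M.
Proof.
have sQ e k : (sgd e *: sip k) *m (sgd e *: sip k) = 1%:M.
  by rewrite -scalemxAl scalemx_sgdr scalerA sgd_sgd scale1r sip_sip.
by case: g => [k l e|k a b|k l|k e|k]; rewrite /blkH ?mulmx_block
  !(mul0mx, mulmx0, add0r, addr0, sip_sip, sQ, mulmxN, mulNmx, opprK) -?scalar_mx_block.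
Qed.

Lemma eq_toep_mod k f g q : f = g + q * 'X^(k.+1) -> toep k f = toep k g.
Proof. by move=> ->; rewrite exprSr mulrA mulrAC toepD toep_mulXn addr0. Qed.

Lemma C2_neq0 (F : numFieldType) : 2 != 0 :> F.
Proof. by rewrite pnatr_eq0. Qed.

(** A positive constant term allows a root with real coefficients, and real coefficients make
    [toep k s] selfadjoint for [sip k]. *)
Lemma toep_sqrt_real k (c : {poly R}) : 0 < c`_0 ->
  exists s, cpoly s = s /\ toep k (s * s) = toep k (map_poly RtoC c).
Proof.
move=> c0; have [||s [u [q [q' [_ sE _]]]]] := @sqrt_trunc R c (Num.sqrt c`_0)^-1 k.
- exact: C2_neq0.
- by rewrite exprVn sqr_sqrtr ?ltW // mulVf // gt_eqF.
exists (map_poly RtoC s); rewrite cpolyRtoC -rmorphM -expr2 sE; split=> //.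
by apply: (@eq_toep_mod _ _ _ (map_poly RtoC q)); rewrite rmorphD rmorphM /= map_polyXn.
Qed.

Lemma toep_sqrt k (c : {poly C}) : c`_0 != 0 ->
  exists s, toep k (s * s) = toep k c /\ toep k (cpoly s * cpoly s) = toep k (cpoly c).
Proof.
move=> c0; have [||s [u [q [q' [_ sE _]]]]] := @sqrt_trunc C c (sqrtC c`_0)^-1 k.
- exact: C2_neq0.
- by rewrite exprVn sqrtCK mulVf.
exists s; rewrite -rmorphM -expr2 sE; split; first exact: eq_toep_mod.
by apply: (@eq_toep_mod _ _ _ (cpoly q)); rewrite rmorphD rmorphM /= map_polyXn.
Qed.

Lemma cpolyK f : cpoly (cpoly f) = f.
Proof. by apply/polyP=> i; rewrite !coef_map; case: (f`_i) => a b; rewrite /= opprK. Qed.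

Lemma toep_linv k (c : {poly C}) : c`_0 != 0 -> exists u, toep k u *m toep k c = 1%:M.
Proof.
move=> c0; have [||s [u [q [q' [_ _ uE]]]]] := @sqrt_trunc C c (sqrtC c`_0)^-1 k.
- exact: C2_neq0.
- by rewrite exprVn sqrtCK mulVf.
by exists u; rewrite toepM (eq_toep_mod uE) toep1.
Qed.

Lemma coef0_jordan (F : nzRingType) (c : F) : ('X + c%:P)`_0 = c.
Proof. by rewrite coefD coefX coefC add0r. Qed.

Definition blk_root g (M : 'M[D]_(cg_size g)) :=
  M *m M = blkB g /\ (forall x : 'cV[D]_(cg_size g), M *m x = 0 <-> exists a, x = blkK g *m a).

Lemma blk_root_inv g (M U : 'M[D]_(cg_size g)) : blkK g = 0 -> M *m M = blkB g ->
  U *m blkB g = 1%:M -> blk_root M.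
Proof.
move=> K0 MM UB; split=> // x; rewrite K0; split=> [Mx|[a ->]]; last by rewrite mul0mx mulmx0.
by exists 0; rewrite mul0mx -[x]mul1mx -UB -MM -!mulmxA Mx !mulmx0.
Qed.

Lemma jordan_block_linv k (c d : C) : c != 0 -> d != 0 ->
  exists U, U *m block_mx (jordan k c) 0 0 (jordan k d) = 1%:M.
Proof.
move=> c0 d0; have [|u uE] := @toep_linv k ('X + c%:P); first by rewrite coef0_jordan.
have [|v vE] := @toep_linv k ('X + d%:P); first by rewrite coef0_jordan.
exists (block_mx (toep k u) 0 0 (toep k v)).
by rewrite mulmx_block uE vE !(mul0mx, mulmx0, add0r, addr0) -scalar_mx_block.
Qed.

Lemma blkB_linv g : cg_valid g -> (if g is (GZodd _ _ | GZeven _) then false else true) ->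
  exists U, U *m blkB g = 1%:M.
Proof.
case: g => [k l e|k a b|k l|//|//] /= /andP[_ l0] _.
- have [|u uE] := @toep_linv k ('X + l%:C%C%:P); last by exists (toep k u).
  by rewrite coef0_jordan fmorph_eq0 gt_eqF.
- by apply: jordan_block_linv; rewrite eq_complex /= ?oppr_eq0 (gt_eqF l0) andbF.
- by apply: jordan_block_linv; rewrite fmorph_eq0 lt_eqF.
Qed.

(** At a nonzero eigenvalue [blkB g] is invertible, so any square root is injective, in agreement
    with the empty list of kernel generators. *)
Lemma blk_root_nonzero g (M : 'M[D]_(cg_size g)) : cg_valid g ->
  (if g is (GZodd _ _ | GZeven _) then false else true) -> M *m M = blkB g -> blk_root M.
Proof.
move=> gv g0 MM; have [U UB] := blkB_linv gv g0; apply: (blk_root_inv _ MM UB).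
by case: g g0 {M MM U UB gv}.
Qed.

Lemma adj_scale_sgd m n e (A : 'M[D]_(m, n)) : adj (sgd e *: A) = sgd e *: adj A.
Proof. by case: e; rewrite /sgd ?scale1r // !scaleN1r raddfN. Qed.

(** With [c = 1/2] this is the obvious root [0 N; 1 0] of [N] plus [N], rotated by 45 degrees so
    that the hyperbolic form becomes [Q_k] plus [-Q_k]; see [rot_even]. *)
Definition rooteven k (c : {poly C}) : 'M[D]_(k + k) :=
  block_mx (toep k (c * (1 + 'X))) (toep k (c * ('X - 1)))
           (toep k (c * (1 - 'X))) (toep k (c * (- 1 - 'X))).

Lemma block_mul_col_eq0 m1 m2 n1 n2 (A : 'M[D]_(m1, n1)) B A3 (A4 : 'M[D]_(m2, n2)) x y :
  block_mx A B A3 A4 *m col_mx x y = 0 :> 'cV_(m1 + m2) ->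
  A *m x + B *m y = 0 /\ A3 *m x + A4 *m y = 0.
Proof. by rewrite mul_block_col -[0]vsubmxK => /eq_col_mx[-> ->]; rewrite !linear0. Qed.

(** The sum of the two block rows forces equal halves, and the first row then reads [N y = 0]. This
    is the origin of the generators [e_{i,1} + e_{i,k_i+1}]. *)
Lemma rooteven_eq0 k c (x : 'cV[D]_(k + k)) : c + c = 1 ->
  rooteven k c *m x = 0 -> exists2 y, x = col_mx y y & toep k 'X *m y = 0.
Proof.
rewrite /rooteven => cc; rewrite -[x]vsubmxK; move: (usubmx x) (dsubmx x) => {x} x y.
move=> /block_mul_col_eq0[top bot].
have xy : x = y.
  apply/eqP; rewrite -subr_eq0; apply/eqP.
  have := congr2 +%R top bot; rewrite addrACA -!mulmxDl -!toepD addr0.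
  have -> : c * (1 + 'X) + c * (1 - 'X) = c + c by ring.
  have -> : c * ('X - 1) + c * (-1 - 'X) = - (c + c) by ring.
  by rewrite cc toepN toep1 mul1mx mulNmx mul1mx.
exists y; first by rewrite xy.
move: top; rewrite xy -mulmxDl -toepD.
have -> : c * (1 + 'X) + c * ('X - 1) = (c + c) * 'X by ring.
by rewrite cc mul1r.
Qed.

Lemma toepX_ker k (x : 'cV[D]_k) :
  toep k 'X *m x = 0 <-> exists a : 'M_1, x = unit0 k *m a.
Proof.
have toepXE (y : 'cV[D]_k) (i j : 'I_k) : j = i.+1 :> nat -> (toep k 'X *m y) i 0 = y j 0.
  move=> ji; rewrite mxE (bigD1 j) //= big1 ?addr0 => [|l lj].
    by rewrite mxE coefX ji leqnSn subSnn rmorph1 mul1r.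
  rewrite mxE coefX; case: leqP => [il|]; last by rewrite mul0r.
  case: eqP => [li|_]; last by rewrite rmorph0 mul0r.
  by case/eqP: lj; apply/val_inj; rewrite /= ji; lia.
split=> [Tx|[a ->]].
  case: k x Tx toepXE => [|k] x Tx toepXE.
    by exists 0; apply/matrixP=> -[].
  exists (x 0 0)%:M; apply/colP=> i; rewrite mxE big_ord1 !mxE eqxx mulr1n.
  case: eqP => [i0|/eqP]; first by rewrite mul1r; congr (x _ _); apply/val_inj.
  rewrite -lt0n mul0r => i0; have ik : (i.-1 < k.+1)%N by have := ltn_ord i; lia.
  by rewrite -(toepXE _ (Ordinal ik)) /= ?prednK // Tx mxE.
apply/colP=> i; rewrite [RHS]mxE mulmxA mxE big1 // => l _; rewrite [l]ord1.
case: (ltnP i.+1 k) => ik.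
  by rewrite (toepXE _ _ (Ordinal ik)) // mxE mul0r.
rewrite mxE big1 ?mul0r // => m _; rewrite !mxE coefX; case: leqP => [|_]; last by rewrite mul0r.
move=> im; have -> : (m - i == 1)%N = false by have := ltn_ord m; lia.
by rewrite rmorph0 mul0r.
Qed.

(** [downP] and [shiftP] factor the nilpotent shifts of sizes [k+1] and [k] in the two possible
    orders, and the forms [Q_(k+1)] and [Q_k] make them adjoint to each other. Thus the root
    [rootodd] alternates between the two Jordan chains. *)
Definition downP k : 'M[D]_(k.+1, k) := \matrix_(i, j) if i == j :> nat then 1 else 0.
Definition shiftP k : 'M[D]_(k, k.+1) := \matrix_(i, j) if j == i.+1 :> nat then 1 else 0.

Lemma mul_shiftP k m (M : 'M[D]_(k.+1, m)) i j : (shiftP k *m M) i j = M (lift ord0 i) j.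
Proof.
rewrite mxE (bigD1 (lift ord0 i)) //= big1 ?addr0 => [|l li]; rewrite !mxE.
  by rewrite eqxx mul1r.
case: eqP => [li'|_]; last by rewrite mul0r.
by case/eqP: li; apply/val_inj.
Qed.

Lemma mul_downP k m (M : 'M[D]_(k, m)) (i : 'I_k) j :
  (downP k *m M) (widen_ord (leqnSn k) i) j = M i j.
Proof.
rewrite mxE (bigD1 i) //= big1 ?addr0 => [|l li]; rewrite !mxE.
  by rewrite eqxx mul1r.
by rewrite eq_sym val_eqE (negPf li) mul0r.
Qed.

Lemma mul_downP_max k m (M : 'M[D]_(k, m)) j : (downP k *m M) ord_max j = 0.
Proof.
by rewrite mxE big1 // => l _; rewrite mxE /= gtn_eqF ?mul0r.
Qed.

Lemma downP_shiftP k : downP k *m shiftP k = toep k.+1 'X.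
Proof.
apply/matrixP=> i j; have [ik|ik] := ltnP i k.
  have -> : i = widen_ord (leqnSn k) (Ordinal ik) by apply/val_inj.
  rewrite mul_downP !mxE coefX /=.
  case: eqP => [->|ij]; first by rewrite leqnSn subSnn rmorph1.
  case: leqP => // ij'; have -> : (j - i == 1)%N = false by lia.
  by rewrite rmorph0.
have -> : i = ord_max by apply/val_inj => /=; have := ltn_ord i; lia.
rewrite mul_downP_max mxE coefX /=; case: leqP => // kj.
have -> : (j - k == 1)%N = false by have := ltn_ord j; lia.
by rewrite rmorph0.
Qed.

Lemma shiftP_downP k : shiftP k *m downP k = toep k 'X.
Proof.
apply/matrixP=> i j; rewrite mul_shiftP !mxE coefX /= /bump /= add1n eq_sym.
case: eqP => [->|ij]; first by rewrite leqnSn subSnn rmorph1.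
case: leqP => // ij'; have -> : (j - i == 1)%N = false by lia.
  by rewrite rmorph0.
Qed.

Lemma adj_downP k : adj (downP k) *m sip k.+1 = sip k *m shiftP k.
Proof.
apply/matrixP=> i j; rewrite mul_sip mul_sipr !mxE /=.
have := ltn_ord i; have := ltn_ord j => jk ik.
have -> : (k.+1 - j.+1 == i)%N = (j == (k - i.+1).+1 :> nat)%N by lia.
by case: eqP; rewrite ?conj1 ?raddf0.
Qed.

Lemma adj_shiftP k : adj (shiftP k) *m sip k = sip k.+1 *m downP k.
Proof.
apply/matrixP=> i j; rewrite mul_sip mul_sipr !mxE /=.
have := ltn_ord i; have := ltn_ord j => jk ik.
have -> : (i == (k - j.+1).+1 :> nat)%N = (k.+1 - i.+1 == j)%N by lia.
by case: eqP; rewrite ?conj1 ?raddf0.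
Qed.

Definition rootodd k : 'M[D]_(k.+1 + k) := block_mx 0 (downP k) (shiftP k) 0.
Lemma rootodd_root k e : blk_root (g := GZodd R k e) (rootodd k).
Proof.
have sq : rootodd k *m rootodd k = blkB (GZodd R k e).
  by rewrite /rootodd mulmx_block !(mul0mx, mulmx0, add0r, addr0) downP_shiftP shiftP_downP.
split=> // x; split=> [|[a ->]].
  rewrite -[x]vsubmxK; move: (usubmx x) (dsubmx x) => {x} x y.
  move=> /block_mul_col_eq0[]; rewrite !mul0mx add0r addr0 => Py Sx.
  have y0 : y = 0.
    by apply/colP => i; rewrite -mul_downP Py !mxE.
  have [a ->] : exists a : 'M_1, x = unit0 k.+1 *m a.
    by apply/toepX_ker; rewrite -downP_shiftP -mulmxA Sx mulmx0.
  by exists a; rewrite y0 mul_col_mx mul0mx.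
have -> : blkK (GZodd R k e) *m a = col_mx (unit0 k.+1 *m a) 0.
  by rewrite [LHS]mul_col_mx mul0mx.
rewrite /rootodd mul_block_col mul0mx !mulmx0 !addr0 mulmxA.
have -> : shiftP k *m unit0 k.+1 = 0 by apply/colP=> i; rewrite mul_shiftP !mxE.
by rewrite mul0mx col_mx0.
Qed.

Lemma rooteven_root k c : c + c = 1 -> blk_root (g := GZeven R k) (rooteven k c).
Proof.
move=> cc; have zero x := @rooteven_eq0 k c x cc.
rewrite /blk_root /rooteven /blkB /blkK; split.
  rewrite mulmx_block !toepM -!toepD.
  have -> : c * (1 + 'X) * (c * (1 + 'X)) + c * ('X - 1) * (c * (1 - 'X)) =
    (c + c) * (c + c) * 'X by ring.
  have -> : c * (1 + 'X) * (c * ('X - 1)) + c * ('X - 1) * (c * (-1 - 'X)) = 0 by ring.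
  have -> : c * (1 - 'X) * (c * (1 + 'X)) + c * (-1 - 'X) * (c * (1 - 'X)) = 0 by ring.
  have -> : c * (1 - 'X) * (c * ('X - 1)) + c * (-1 - 'X) * (c * (-1 - 'X)) =
    (c + c) * (c + c) * 'X by ring.
  by rewrite cc !mul1r toep0.
split=> [/zero[y -> /toepX_ker[a ->]]|[a ->]]; first by exists a; rewrite mul_col_mx.
have -> : col_mx (unit0 k) (unit0 k) *m a = col_mx (unit0 k *m a) (unit0 k *m a).
  by rewrite [LHS]mul_col_mx.
rewrite mul_block_col -!mulmxDl -!toepD.
have -> : c * (1 + 'X) + c * ('X - 1) = (c + c) * 'X by ring.
have -> : c * (1 - 'X) + c * (- 1 - 'X) = - ((c + c) * 'X) by ring.
rewrite cc mul1r toepN mulNmx; have -> : toep k 'X *m (unit0 k *m a) = 0.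
  by apply/toepX_ker; exists a.
by rewrite oppr0 col_mx0.
Qed.

Lemma block_toep_sip k f1 f2 f3 f4 :
  adj (block_mx (toep k f1) (toep k f2) (toep k f3) (toep k f4)) *m
    block_mx (sip k) 0 0 (- sip k) =
  block_mx (sip k *m toep k (cpoly f1)) (- (sip k *m toep k (cpoly f3)))
           (sip k *m toep k (cpoly f2)) (- (sip k *m toep k (cpoly f4))).
Proof. by rewrite adj_block_mx mulmx_block !mulmx0 !addr0 !add0r !mulmxN !toep_sip. Qed.

Lemma mul_sip_block k (A B A3 A4 : 'M[D]_k) :
  block_mx (sip k) 0 0 (- sip k) *m block_mx A B A3 A4 =
  block_mx (sip k *m A) (sip k *m B) (- (sip k *m A3)) (- (sip k *m A4)).
Proof. by rewrite mulmx_block !mul0mx !addr0 !add0r !mulNmx. Qed.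

Lemma blk_root_exists g : cg_valid g ->
  exists M : 'M[D]_(cg_size g), blk_root M /\ adj M *m blkH g = blkH g *m M.
Proof.
case: g => [k l e|k a b|k l|k e|k] gv.
- have [|s [sc ss]] := @toep_sqrt_real k ('X + l%:P); first by rewrite coef0_jordan; case/andP: gv.
  exists (toep k s); split.
    apply: blk_root_nonzero => //; rewrite toepM ss /blkB /jordan.
    by rewrite rmorphD /= map_polyX map_polyC.
  by rewrite /blkH scalemx_sgdr -scalemxAl toep_sip sc.
(* The form pairs the two summands, so a root [s] on the first imposes the conjugate root on the
   second. *)
- have [|s [ss ss']] := @toep_sqrt k ('X + (Complex a b)%:P).
    by rewrite coef0_jordan eq_complex /= andbC; case/andP: gv => _ /gt_eqF ->.
  rewrite rmorphD /= map_polyX map_polyC /= in ss'.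
  exists (block_mx (toep k s) 0 0 (toep k (cpoly s))); split.
    apply: blk_root_nonzero => //.
    by rewrite mulmx_block !(mul0mx, mulmx0, add0r, addr0) !toepM ss ss'.
  rewrite adj_block_mx /blkH !mulmx_block !raddf0 /=.
  by rewrite !(mul0mx, mulmx0, add0r, addr0) !toep_sip cpolyK.
(* Here [-(lambda + X)] has a real root [s]. The matrix [0 -s; s 0] squares to [-s^2] and is
   selfadjoint because the two summands of the form have opposite signs. *)
- have [|s [sc ss]] := @toep_sqrt_real k (- ('X + l%:P)).
    by rewrite coefN coef0_jordan oppr_gt0; case/andP: gv.
  have ss' : toep k (s * s) = - jordan k l%:C%C.
    by rewrite ss /jordan -toepN rmorphN rmorphD /= map_polyX map_polyC.
  exists (block_mx 0 (- toep k s) (toep k s) 0); split.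
    apply: blk_root_nonzero => //.
    by rewrite mulmx_block !(mul0mx, mulmx0, add0r, addr0) mulNmx mulmxN toepM ss' opprK.
  rewrite adj_block_mx /blkH !mulmx_block !raddf0 !raddfN /=.
  by rewrite !(mul0mx, mulmx0, add0r, addr0, mulmxN, mulNmx) !toep_sip sc.
- exists (rootodd k); split; first exact: rootodd_root.
  rewrite /rootodd adj_block_mx /blkH !mulmx_block !raddf0 /=.
  by rewrite !(mul0mx, mulmx0, add0r, addr0) !scalemx_sgdr -!scalemxAl adj_downP adj_shiftP.
have [c [cc cc']] : exists c : {poly C}, c + c = 1 /\ cpoly c = c.
  exists (map_poly RtoC (2^-1)%:P); rewrite cpolyRtoC -!rmorphD /= -[X in X + X]mul1r -splitr.
  by rewrite rmorph1.
exists (rooteven k c); split; first exact: rooteven_root.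
rewrite [blkH _]/= block_toep_sip mul_sip_block.
rewrite !(rmorphM, rmorphD, rmorphN, rmorph1) /= map_polyX cc'.
by rewrite -[1 - 'X]opprB mulrN toepN mulmxN !opprK.
Qed.

(** * Direct sums of blocks and the polar decomposition they yield *)

Fixpoint canMB (s : seq (cgroup R)) : 'M[D]_(can_size s) :=
  if s is g :: s' then block_mx (blkB g) 0 0 (canMB s') else 0.
Fixpoint canMH (s : seq (cgroup R)) : 'M[D]_(can_size s) :=
  if s is g :: s' then block_mx (blkH g) 0 0 (canMH s') else 0.
Definition ker_size (s : seq (cgroup R)) := sumn [seq size (cg_ker g) | g <- s].
Fixpoint canMK (s : seq (cgroup R)) : 'M[D]_(can_size s, ker_size s) :=
  if s is g :: s' then block_mx (blkK g) 0 0 (canMK s') else 0.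

(** [X] enters only through its kernel, so the form found for a selfadjoint [A] and [A^2] passes to
    [X] and [B]. [S] has rectangular type; its two-sided inverse forces [n = can_size s]. *)
Definition canonical n (H B X : 'M[D]_n) s :=
  exists (S : 'M[D]_(n, can_size s)) (Sinv : 'M[D]_(can_size s, n)),
  [/\ all (@cg_valid R) s, S *m Sinv = 1%:M /\ Sinv *m S = 1%:M,
      B *m S = S *m canMB s, adj S *m H *m S = canMH s &
      forall v : 'cV[D]_n, X *m v = 0 <-> exists a, v = S *m canMK s *m a].

Lemma block_diag_mul_col m1 m2 n1 n2 (A : 'M[D]_(m1, n1)) (B : 'M[D]_(m2, n2))
    (x : 'cV[D]_n1) (y : 'cV[D]_n2) :
  block_mx A 0 0 B *m col_mx x y = col_mx (A *m x) (B *m y).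
Proof. by rewrite mul_block_col !mul0mx addr0 add0r. Qed.

Lemma can_root_exists s : all (@cg_valid R) s ->
  exists M : 'M[D]_(can_size s), [/\ M *m M = canMB s, adj M *m canMH s = canMH s *m M &
    forall x : 'cV[D]_(can_size s), M *m x = 0 <-> exists a, x = canMK s *m a].
Proof.
elim: s => [_|g s IHs /= /andP[gv /IHs[M [MM MH Mker]]]].
  exists 0; split; rewrite ?mulmx0 ?mul0mx //.
  by move=> x; split=> [_|_]; [exists 0|]; apply/matrixP=> -[].
have [N [[NN Nker] NH]] := blk_root_exists gv.
exists (block_mx N 0 0 M); split.
- by rewrite mulmx_block !(mul0mx, mulmx0, add0r, addr0) NN MM.
- rewrite adj_block_mx !raddf0 /= !mulmx_block.
  by rewrite !(mul0mx, mulmx0, add0r, addr0) NH MH.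
move=> x; rewrite -[x]vsubmxK; move: (usubmx x) (dsubmx x) => {x} x y.
split=> [/block_mul_col_eq0[]|[a]].
  rewrite !mul0mx add0r addr0 => /Nker[a ->] /Mker[b ->].
  by exists (col_mx a b); rewrite [RHS]block_diag_mul_col.
rewrite -[a]vsubmxK => /esym; rewrite [LHS]block_diag_mul_col => /eq_col_mx[xE yE].
rewrite block_diag_mul_col.
have -> : N *m x = 0 by apply/Nker; eexists; exact/esym/xE.
have -> : M *m y = 0 by apply/Mker; eexists; exact/esym/yE.
by rewrite col_mx0.
Qed.

Definition polar n (H Hinv X : 'M[D]_n) := exists U A : 'M[D]_n,
  adj U *m H *m U = H /\ Hinv *m adj A *m H = A /\ X = U *m A.

Lemma polar_of_canonical n (H Hinv X : 'M[D]_n) s :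
  adj H = H -> H *m Hinv = 1%:M -> Hinv *m H = 1%:M ->
  canonical H (Hinv *m adj X *m H *m X) X s -> polar H Hinv X.
Proof.
move=> Hadj HHinv HinvH [S [Sinv [sv [SSinv SinvS] BS SHS kerX]]].
have [M [MM MH Mker]] := can_root_exists sv.
pose A := S *m M *m Sinv.
have AA : A *m A = Hinv *m adj X *m H *m X.
  rewrite /A !mulmxA -(mulmxA (S *m M)) SinvS mulmx1 -(mulmxA S) MM -BS.
  by rewrite -!mulmxA SSinv mulmx1.
have adjS : adj Sinv *m adj S = 1%:M by rewrite -adjM SSinv adj1.
have adjS' : adj S *m adj Sinv = 1%:M by rewrite -adjM SinvS adj1.
have HE : H = adj Sinv *m canMH s *m Sinv.
  by rewrite -SHS !mulmxA adjS mul1mx -mulmxA SSinv mulmx1.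
have AH : adj A *m H = H *m A.
  rewrite {1}HE /A !adjM !mulmxA -(mulmxA _ (adj S)) adjS' mulmx1.
  rewrite -(mulmxA (adj Sinv)) MH HE !mulmxA -(mulmxA _ Sinv S) SinvS mulmx1 //.
have [||U [UH XE]] := @unitary_factor_exists n H Hinv Hadj HHinv HinvH X A.
- by rewrite AH -(mulmxA H A) AA !mulmxA HHinv mul1mx.
- move=> v; rewrite kerX; have -> : (A *m v = 0) <-> (M *m (Sinv *m v) = 0).
    rewrite /A -!mulmxA; split=> [SM|->]; last by rewrite mulmx0.
    by rewrite -[LHS]mul1mx -SinvS -mulmxA SM mulmx0.
  rewrite Mker; split=> -[a aE]; exists a.
    by rewrite aE !mulmxA SinvS mul1mx.
  by rewrite -mulmxA -aE mulmxA SSinv mul1mx.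
by exists U, A; split=> //; rewrite -mulmxA AH mulmxA HinvH mul1mx.
Qed.

(** * Induction step: passing to the orthogonal complement of a block *)

Lemma cg_size_gt0 (g : cgroup R) : cg_valid g -> (0 < cg_size g)%N.
Proof.
by case: g => [k l e|k a b|k l|k e|k] //=; rewrite ?addn_gt0 ?orbb // => /andP[].
Qed.

(** The Gram matrix of [E] is invertible, so its span has an orthogonal complement, which is
    [A]-invariant because [A] is selfadjoint. The basis is [E] followed by the image under [F] of
    the basis found for the complement. *)
Lemma canonical_step n (H Hinv A : 'M[D]_n) g (E : 'M[D]_(n, cg_size g)) M :
  adj H = H -> H *m Hinv = 1%:M -> Hinv *m H = 1%:M -> adj A *m H = H *m A ->
  cg_valid g -> adj E *m H *m E = blkH g -> A *m E = E *m M -> blk_root M ->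
  (forall n' (H' Hinv' A' : 'M[D]_n'), (n' < n)%N ->
    adj H' = H' -> H' *m Hinv' = 1%:M -> Hinv' *m H' = 1%:M -> adj A' *m H' = H' *m A' ->
    exists s, canonical H' (A' *m A') A' s) ->
  exists s, canonical H (A *m A) A s.
Proof.
move=> Hadj HHinv HinvH AH gv EHE AE [MM Mker] IH.
(* Coordinates of the [H]-orthogonal projection onto the span of [E]; [blkH g] is its own inverse.
   Hence the kernel [F] of [P] is the orthogonal complement. *)
pose P := blkH g *m adj E *m H.
have PE : P *m E = 1%:M by rewrite /P -!mulmxA (mulmxA (adj E)) EHE blkH_inv.
have [n' [F [F' [nE PF FE F'F EPFF]]]] := complement PE.
have FF' : F *m F' = 1%:M - E *m P by rewrite -EPFF addrC addKr.
have EHF : adj E *m H *m F = 0.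
  by have := congr1 (mulmx (blkH g)) PF; rewrite /P !mulmxA blkH_inv mul1mx mulmx0.
have FHE : adj F *m H *m E = 0.
  by have := congr1 (@adj _ _) EHF; rewrite !adjM adjK Hadj raddf0 mulmxA.
have aFF : adj F' *m adj F = 1%:M - adj P *m adj E.
  by rewrite -adjM FF' raddfB /= adj1 adjM.
have EHA : adj E *m H *m A = adj M *m (adj E *m H).
  by rewrite -mulmxA -AH mulmxA -adjM AE adjM mulmxA.
pose A' := F' *m A *m F.
have FA' : F *m A' = A *m F.
  rewrite /A' !mulmxA FF' !mulmxBl mul1mx -!(mulmxA E).
  suff -> : P *m A *m F = 0 by rewrite mulmx0 subr0.
  by rewrite /P -!(mulmxA (blkH g)) EHA -(mulmxA (adj M)) EHF !mulmx0.
have aFHF : adj F' *m (adj F *m H *m F) = H *m F.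
  by rewrite !mulmxA aFF !mulmxBl mul1mx -!(mulmxA (adj P)) EHF mulmx0 subr0.
have [|||||s [S [Sinv [sv [SSinv SinvS] BS SHS kerA]]]] :=
    IH n' (adj F *m H *m F) (F' *m Hinv *m adj F') A'.
- by rewrite nE -[X in (X < _)%N]add0n ltn_add2r cg_size_gt0.
- by rewrite !adjM adjK Hadj mulmxA.
- rewrite !mulmxA -(mulmxA _ F F') FF' mulmxBr mulmx1 mulmxA FHE mul0mx subr0.
  by rewrite -(mulmxA _ H) HHinv mulmx1 -adjM F'F adj1.
- by rewrite -(mulmxA (F' *m Hinv)) aFHF mulmxA -(mulmxA F') HinvH mulmx1 F'F.
- rewrite -(mulmxA (adj F *m H)) FA' /A' !adjM (mulmxA (adj F) (adj A)) -(mulmxA _ (adj F')) aFHF.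
  by rewrite !mulmxA -(mulmxA (adj F) (adj A)) AH !mulmxA.
clearbody P A'.
exists (g :: s), (row_mx E (F *m S)), (col_mx P (Sinv *m F')); split.
- by rewrite /= gv.
- split.
    by rewrite [LHS]mul_row_col mulmxA -(mulmxA F) SSinv mulmx1 EPFF.
  rewrite [LHS]mul_col_row PE mulmxA PF mul0mx -mulmxA FE mulmx0.
  by rewrite mulmxA -(mulmxA Sinv) F'F mulmx1 SinvS -scalar_mx_block.
- rewrite [LHS]mul_mx_row [RHS]mul_row_block !mulmx0 addr0 add0r -mulmxA AE mulmxA AE.
  by rewrite -(mulmxA E) MM -(mulmxA F) -BS -(mulmxA A) !(mulmxA A F)
    -FA' !mulmxA -(mulmxA F) -!FA' mulmxA.
- have EHFS : adj E *m H *m (F *m S) = 0 by rewrite mulmxA EHF mul0mx.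
  have FSHE : adj (F *m S) *m H *m E = 0 by rewrite adjM -!(mulmxA (adj S)) FHE mulmx0.
  have FSHFS : adj (F *m S) *m H *m (F *m S) = canMH s by rewrite adjM -SHS !mulmxA.
  by rewrite adj_row_mx [X in X *m _]mul_col_mx [LHS]mul_col_row EHE EHFS FSHE FSHFS.
move=> v.
have vE : v = E *m (P *m v) + F *m (F' *m v) by rewrite !mulmxA -mulmxDl EPFF mul1mx.
have Av : A *m v = E *m (M *m (P *m v)) + F *m (A' *m (F' *m v)).
  by rewrite {1}vE mulmxDr !mulmxA AE FA'.
split=> [Av0|[a]].
  have MP : M *m (P *m v) = 0.
    have := congr1 (mulmx P) Av; rewrite Av0 mulmx0 mulmxDr !(mulmxA P) PE PF mul1mx mul0mx addr0.
    by move=> <-.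
  have AF : A' *m (F' *m v) = 0.
    have := congr1 (mulmx F') Av.
    rewrite Av0 mulmx0 mulmxDr !(mulmxA F') FE F'F mul1mx mul0mx add0r.
    by move=> <-.
  have [[a aE] [b bE]] := (proj1 (Mker _) MP, proj1 (kerA _) AF).
  exists (col_mx a b); rewrite -[RHS]mulmxA [X in _ *m X]block_diag_mul_col.
  by rewrite [RHS]mul_row_col -aE -mulmxA (mulmxA S) -bE.
rewrite -[a]vsubmxK -mulmxA [X in _ *m X]block_diag_mul_col mul_row_col => {}vE.
rewrite vE mulmxDr !mulmxA AE -FA' -!mulmxA.
have -> : M *m (blkK g *m usubmx a) = 0 by apply/Mker; eexists.
rewrite (mulmxA S); have -> : A' *m (S *m canMK s *m dsubmx a) = 0 by apply/kerA; eexists.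
by rewrite !mulmx0 addr0.
Qed.

(* For [s^2 = 1/2] this rotates a hyperbolic pair of chains, with Gram matrix [0 Q; Q 0], into
   two orthogonal chains of opposite signs. *)
Definition rot k (s : {poly C}) : 'M[D]_(k + k) :=
  block_mx (toep k s) (- toep k s) (toep k s) (toep k s).
Definition rot_inv k (s : {poly C}) : 'M[D]_(k + k) :=
  block_mx (toep k s) (toep k s) (- toep k s) (toep k s).

Lemma toep_commute k f g : toep k f *m toep k g = toep k g *m toep k f.
Proof. by rewrite !toepM mulrC. Qed.

Lemma rotK k s : s * s + s * s = 1 -> rot k s *m rot_inv k s = 1%:M.
Proof.
move=> ss; rewrite mulmx_block !(mulmxN, mulNmx) opprK subrr.
by rewrite toepM -toepD ss toep1 -scalar_mx_block.
Qed.

Lemma rot_conj k m s (Z : 'M[D]_(k + k, m)) (T : 'M[D]_(m, k + k)) : s * s + s * s = 1 ->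
  rot k s *m (rot_inv k s *m Z *m T) = Z *m T.
Proof. by move=> ss; rewrite !mulmxA rotK // mul1mx. Qed.

Lemma rot_gram k s : s * s + s * s = 1 -> cpoly s = s ->
  adj (rot k s) *m block_mx 0 (sip k) (sip k) 0 *m rot k s =
  block_mx (sip k) 0 0 (- sip k).
Proof.
move=> ss sc; rewrite adj_block_mx !raddfN /= mulmx_block.
rewrite !(mulmx0, add0r, addr0, mulNmx) !toep_sip sc mulmx_block !(mulmxN, mulNmx).
by rewrite -!mulmxA toepM addNr subrr -opprD -mulmxDr -toepD ss toep1 mulmx1.
Qed.

Lemma rot_diag k s f : rot k s *m block_mx (toep k f) 0 0 (toep k f) =
  block_mx (toep k f) 0 0 (toep k f) *m rot k s.
Proof.
rewrite !mulmx_block !(mulmx0, mul0mx, add0r, addr0, mulmxN, mulNmx).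
by rewrite (toep_commute _ s f).
Qed.

Lemma rot_even k s : rot_inv k s *m block_mx 0 (toep k 'X) 1%:M 0 *m rot k s =
  rooteven k (s * s).
Proof.
rewrite /rooteven !mulmx_block -(toep1 k) !(mulmx0, add0r, addr0, mulmxN, mulNmx).
rewrite !toepM -!toepN -!toepD.
by congr block_mx; congr toep; ring.
Qed.

Lemma blk_root_sgd (g : cgroup R) (M : 'M[D]_(cg_size g)) e :
  blk_root M -> blk_root (sgd e *: M).
Proof.
move=> [MM Mker]; split.
  by rewrite -scalemxAl scalemx_sgdr scalerA sgd_sgd scale1r.
move=> x; rewrite -Mker -scalemxAl; split=> [|->]; last by rewrite scaler0.
by move=> /(congr1 (fun y => sgd e *: y)); rewrite scalerA sgd_sgd scale1r scaler0.
Qed.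

Lemma half_sqrt : exists s : {poly C}, s * s + s * s = 1 /\ cpoly s = s.
Proof.
exists (map_poly RtoC (Num.sqrt 2^-1)%:P); rewrite cpolyRtoC; split=> //.
rewrite -rmorphM -rmorphD -polyCM -polyCD -expr2 sqr_sqrtr ?invr_ge0 ?ler0n //.
by rewrite -[X in X + X]mul1r -splitr rmorph1.
Qed.

(** * Splitting off a canonical block *)

Section Cyclic.
Variables (n : nat) (H Hinv A : 'M[D]_n).
Hypotheses (Hadj : adj H = H) (HHinv : H *m Hinv = 1%:M).
Hypothesis AH : adj A *m H = H *m A.
Implicit Types (f g : {poly C}) (u v w z : 'cV[D]_n) (q : D).

(** The coefficients multiply on the right, where they commute with [A], so this is a [C[X]]-module
    structure. It commutes with all of [D] only for real [f], as in [act_scaler]. *)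
Definition act (f : {poly C}) (w : 'cV[D]_n) : 'cV[D]_n :=
  \sum_(i < size f) iter i (mulmx A) w *m (iota f`_i)%:M.

Lemma act_widen N f w : (size f <= N)%N ->
  act f w = \sum_(i < N) iter i (mulmx A) w *m (iota f`_i)%:M.
Proof.
move=> fN; apply: (@sum_widen _ (fun i => iter i (mulmx A) w *m (iota f`_i)%:M) _ _ fN) => i fi.
by rewrite nth_default // rmorph0 raddf0 mulmx0.
Qed.

Lemma actD f g w : act (f + g) w = act f w + act g w.
Proof.
pose N := maxn (size f) (size g).
rewrite (@act_widen N (f + g)) ?size_polyD // (@act_widen N f) ?leq_maxl //.
rewrite (@act_widen N g) ?leq_maxr // -big_split; apply: eq_bigr => i _ /=.
by rewrite coefD rmorphD raddfD mulmxDr.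
Qed.

Lemma act0 w : act 0 w = 0.
Proof. by rewrite /act size_poly0 big_ord0. Qed.

Lemma actC c w : act c%:P w = w *m (iota c)%:M.
Proof. by rewrite (@act_widen 1) ?size_polyC_leq1 // big_ord1 coefC. Qed.

Lemma actMX f w : act (f * 'X) w = A *m act f w.
Proof.
rewrite (@act_widen (size f).+1) ?(leq_trans (size_polyMleq _ _)) ?size_polyX ?addn2 //.
rewrite big_ord_recl coefMX rmorph0 raddf0 mulmx0 add0r /act mulmx_sumr.
by apply: eq_bigr => i _; rewrite coefMX /= mulmxA.
Qed.

Lemma actMC f c w : act (f * c%:P) w = act f w *m (iota c)%:M.
Proof.
rewrite (@act_widen (size f)); last first.
  by rewrite mulrC mul_polyC size_scale_leq.
rewrite /act mulmx_suml; apply: eq_bigr => i _.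
by rewrite coefMC rmorphM scalar_mxM mulmxA.
Qed.

Lemma actM f g w : act (f * g) w = act g (act f w).
Proof.
elim/poly_ind: g => [|g c IHg]; first by rewrite mulr0 !act0.
by rewrite mulrDr mulrA !actD !actMX IHg actMC actC.
Qed.

Lemma act1 w : act 1 w = w.
Proof. by rewrite -polyC1 actC rmorph1 mulmx1. Qed.

Lemma herm_sumr (I : finType) u (v : I -> 'cV[D]_n) :
  herm H u (\sum_i v i) = \sum_i herm H u (v i).
Proof. by rewrite /herm mulmx_sumr summxE. Qed.

Lemma herm_A u v : herm H (A *m u) v = herm H u (A *m v).
Proof. by rewrite /herm adjM -!mulmxA (mulmxA (adj A)) AH !mulmxA. Qed.

Lemma herm_iter i u v : herm H (iter i (mulmx A) u) v = herm H u (iter i (mulmx A) v).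
Proof. by elim: i v => //= i IHi v; rewrite herm_A IHi -iterS iterSr. Qed.

Lemma hermZl u v q : herm H (u *m q%:M) v = conj q * herm H u v.
Proof. by rewrite -[LHS]conjK (hermC Hadj) hermZr conjM (hermC Hadj). Qed.

Definition moment w i := re (herm H w (iter i (mulmx A) w)).

Lemma momentE w i : herm H w (iter i (mulmx A) w) = iota (moment w i)%:C%C.
Proof. by apply: conj_fix; rewrite (hermC Hadj) herm_iter. Qed.

(** [[w, f(A) w]] takes values in C because the moments are real, by [momentE]. *)
Definition phi w (f : {poly C}) : C := \sum_(i < size f) (moment w i)%:C%C * f`_i.

Lemma phiE w f : iota (phi w f) = herm H w (act f w).
Proof.
rewrite /phi rmorph_sum herm_sumr; apply: eq_bigr => i _.
by rewrite hermZr momentE rmorphM.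
Qed.

Lemma iota_inj : injective iota. Proof. exact: fmorph_inj. Qed.

Lemma phiD w f g : phi w (f + g) = phi w f + phi w g.
Proof. by apply: iota_inj; rewrite rmorphD !phiE actD hermDr. Qed.

Lemma phiMC w f c : phi w (f * c%:P) = phi w f * c.
Proof. by apply: iota_inj; rewrite rmorphM !phiE actMC hermZr. Qed.

Lemma phi0 w : phi w 0 = 0. Proof. by rewrite /phi size_poly0 big_ord0. Qed.

(** [A] moves across the form and scalars leave the left slot conjugated, so Gram entries depend
    only on the product [cpoly f * g]. *)
Lemma herm_act w f g : herm H (act f w) (act g w) = iota (phi w (cpoly f * g)).
Proof.
elim/poly_ind: f g => [|f c IHf] g.
  by rewrite act0 rmorph0 mul0r phi0 rmorph0 /herm raddf0 !mul0mx mxE.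
rewrite actD actMX actC hermDl herm_A hermZl -actMX IHf rmorphD rmorphM /=.
rewrite map_polyX map_polyC /= mulrDl phiD rmorphD iota_conj; congr (_ + _).
  by rewrite -mulrA [g * _]mulrC.
by rewrite mulrC phiMC mulrC rmorphM -phiE.
Qed.

Lemma phi_conj w f : phi w (cpoly f) = conjc (phi w f).
Proof.
apply: iota_inj; have := herm_act w f 1; rewrite act1 mulr1 => <-.
by rewrite -iota_conj phiE (hermC Hadj).
Qed.

(** * Polynomials annihilating A *)

Definition kills f := forall w, act f w = 0.

Lemma kills_mul f g : kills f -> kills (g * f).
Proof. by move=> kf w; rewrite actM kf. Qed.

Lemma killsD f g : kills f -> kills g -> kills (f + g).
Proof. by move=> kf kg w; rewrite actD kf kg addr0. Qed.

Lemma herm_nondeg z : (forall u, herm H u z = 0) -> z = 0.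
Proof.
move=> Hz; have [y0|/neq0_mulmx_col[c yc]] := eqVneq (adj z *m H) 0.
  by rewrite -[z]adjK -[adj z]mulmx1 -HHinv mulmxA y0 mul0mx raddf0.
have := Hz c; rewrite -(hermC Hadj) /herm yc mxE eqxx conj1 => /eqP.
by rewrite oner_eq0.
Qed.

Lemma cpoly_coef f i : cpoly f = f -> f`_i = (complex.Re f`_i)%:C%C.
Proof.
move=> ff; have := congr1 (fun p : {poly C} => p`_i) ff; rewrite coef_map /=.
case: (f`_i) => a b /= [/eqP]; rewrite eq_sym -addr_eq0 -mulr2n mulrn_eq0 /= => /eqP ->.
by [].
Qed.

Lemma iota_poly_central f i q : cpoly f = f -> iota f`_i * q = q * iota f`_i.
Proof. by move=> /cpoly_coef ->; rewrite iotaC. Qed.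

Lemma act_addr f u v : act f (u + v) = act f u + act f v.
Proof.
rewrite /act -big_split; apply: eq_bigr => i _ /=; rewrite -mulmxDl; congr (_ *m _).
by elim: (nat_of_ord i) => //= j ->; rewrite mulmxDr.
Qed.

Lemma act_scaler f u q : cpoly f = f -> act f (u *m q%:M) = act f u *m q%:M.
Proof.
move=> ff; rewrite /act mulmx_suml; apply: eq_bigr => i _.
have -> : iter i (mulmx A) (u *m q%:M) = iter i (mulmx A) u *m q%:M.
  by elim: (nat_of_ord i) => //= j ->; rewrite mulmxA.
by rewrite -!mulmxA -!scalar_mxM iota_poly_central.
Qed.

Lemma herm_act_self f u v : cpoly f = f -> herm H (act f u) v = herm H u (act f v).
Proof.
move=> ff; rewrite /act herm_sumr -[LHS]conjK (hermC Hadj) herm_sumr raddf_sum.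
apply: eq_bigr => i _ /=; rewrite (hermC Hadj) hermZl herm_iter hermZr.
by rewrite iota_conj -coef_map ff iota_poly_central.
Qed.

(** Polarisation: for self-conjugate [f] the form [[u, f(A) v]] is hermitian over [D]. Were a value
    nonzero, scaling [v] by its inverse [q] would make both cross terms 1, and the form at [u + v q]
    would be 2 instead of 0. *)
Lemma phi_eq0_self f : cpoly f = f -> (forall w, phi w f = 0) -> kills f.
Proof.
move=> ff f0 v; apply: herm_nondeg => u.
have b0 w : herm H w (act f w) = 0 by rewrite -phiE f0 rmorph0.
apply/eqP/negPn/negP => /divD[q bq _].
have := b0 (u + v *m q%:M).
rewrite act_addr act_scaler // !hermDl !hermDr !hermZl !hermZr !b0 mul0r mulr0 !(add0r, addr0).
rewrite bq -{1}(conjK (herm H v (act f u))) (hermC Hadj) herm_act_self //.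
rewrite -conjM bq conj1 => /eqP; rewrite -(rmorph1 iota) -rmorphD fmorph_eq0.
by rewrite -[1 + 1]/(2%:R) pnatr_eq0.
Qed.

(** With [J] the imaginary unit, [f + cpoly f] and [(f - cpoly f) J] are self-conjugate, and [f] is
    recovered from them. *)
Lemma phi_eq0 f : (forall w, phi w f = 0) -> kills f.
Proof.
move=> f0; have f0' w : phi w (cpoly f) = 0 by rewrite phi_conj f0 conjc0.
have k1 : kills (f + cpoly f).
  apply: phi_eq0_self => [|w]; first by rewrite rmorphD /= cpolyK addrC.
  by rewrite phiD f0 f0' addr0.
have [J [JJ Jc]] : exists J : C, J * J = -1 /\ conjc J = - J.
  exists (Complex 0 1); split; apply/eqP; rewrite eq_complex /= ?oppr0 ?eqxx //.
  by apply/andP; split; apply/eqP; ring.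
have k2 : kills ((f - cpoly f) * J%:P).
  apply: phi_eq0_self => [|w].
    by rewrite rmorphM rmorphB /= cpolyK map_polyC /= Jc polyCN mulrN -mulNr opprB.
  by rewrite phiMC -[- cpoly f]mulrN1 -polyCN phiD phiMC f0 f0' mul0r addr0 mul0r.
have k3 : kills (f - cpoly f).
  have -> : f - cpoly f = (- J)%:P * ((f - cpoly f) * J%:P).
    by rewrite mulrCA -polyCM mulNr JJ opprK mulr1.
  exact: kills_mul.
have -> : f = (2%:R^-1)%:P * (f + cpoly f + (f - cpoly f)).
  rewrite addrACA subrr addr0 -mulr2n -[f *+ 2]mulr_natl mulrA -polyC_natr -polyCM.
  by rewrite mulVf ?mul1r // pnatr_eq0.
by apply: kills_mul; apply: killsD.
Qed.

Lemma kills_phi f w : kills f -> phi w f = 0.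
Proof. by move=> kf; apply: iota_inj; rewrite phiE kf rmorph0 /herm mulmx0 mxE. Qed.

Lemma kills_cpoly f : kills f -> kills (cpoly f).
Proof. by move=> kf; apply: phi_eq0 => w; rewrite phi_conj kills_phi // conjc0. Qed.

Lemma not_kills f : ~ kills f -> exists w, phi w f != 0.
Proof.
move=> nkf; apply/not_existsP => f0; apply/nkf/phi_eq0 => w.
by apply/eqP/negPn/negP/f0.
Qed.

(** The [N + 1] first powers of [A] are linearly dependent over R in a space of dimension
    [N = 4 n^2]; real coefficients are central, so the relation annihilates every vector. *)
Lemma kills_exists : exists2 f, f != 0 & kills f.
Proof.
pose T : finType := ('I_n * 'I_n * 'I_4)%type; pose N := #|{: T}|.
pose Apow i : 'M[D]_n := iter i (mulmx A) 1%:M.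
pose V : 'M[R]_(N.+1, N) :=
  \matrix_(i, j) coord (Apow i (enum_val j).1.1 (enum_val j).1.2) 0 (enum_val j).2.
have [c c0 cV] : exists2 c : 'rV_N.+1, c != 0 & c *m V = 0.
  have : kermx V != 0.
    by rewrite kermx_eq0 /row_free neq_ltn ltnS rank_leq_col.
  by case/rowV0Pn => c cV c0; exists c => //; apply/sub_kermxP.
exists (\poly_(i < N.+1) (c 0 (inord i))%:C%C).
  apply: contra_neq c0 => p0; apply/rowP => i; rewrite mxE.
  have := congr1 (fun p : {poly C} => p`_i) p0.
  by rewrite coef_poly ltn_ord coef0 inord_val => -[].
have iterE i w : iter i (mulmx A) w = Apow i *m w.
  by elim: i => [|i IHi]; rewrite /Apow /= ?mul1mx // IHi mulmxA.
move=> w; rewrite (@act_widen N.+1) ?size_poly //.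
have -> : \sum_(i < N.+1) iter i (mulmx A) w *m (iota (\poly_(i < N.+1) (c 0 (inord i))%:C%C)`_i)%:M
   = (\sum_(i < N.+1) iota (c 0 i)%:C%C *: Apow i) *m w.
  rewrite mulmx_suml; apply: eq_bigr => i _; rewrite coef_poly ltn_ord inord_val iterE.
  rewrite -scalemxAl; apply/colP => j; rewrite mxE big_ord1 [RHS]mxE.
  by rewrite [X in _ * X]mxE eqxx mulr1n iotaC.
suff -> : \sum_(i < N.+1) iota (c 0 i)%:C%C *: Apow i = 0 by rewrite mul0mx.
apply/matrixP => a b; rewrite summxE mxE; apply: coord_inj; rewrite raddf_sum /=.
apply/rowP => d; rewrite summxE mxE.
have /rowP/(_ (enum_rank ((a, b, d) : T))) := cV.
rewrite !mxE => {2}<-; apply: eq_bigr => i _.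
by rewrite !mxE enum_rankK /= coordZ mxE.
Qed.

Lemma min_kills : exists m : {poly C}, [/\ m != 0, kills m & forall f, kills f <-> m %| f].
Proof.
have ex : exists N, `[< exists2 f, f != 0 & kills f /\ size f = N >].
  by have [f f0 kf] := kills_exists; exists (size f); apply/asboolP; exists f.
have [N /asboolP[m m0 [km mN]] Nmin] := ex_minnP ex.
exists m; split=> // f; split=> [kf|/dvdpP[q ->]]; last exact: kills_mul.
have kr : kills (f %% m).
  have -> : f %% m = f + (- (f %/ m)) * m by rewrite {2}(divp_eq f m) mulNr addrAC subrr add0r.
  by apply: killsD => //; apply: kills_mul.
rewrite /dvdp; apply/negPn/negP => r0.
have /Nmin : `[< exists2 g, g != 0 & kills g /\ size g = size (f %% m) >].
  by apply/asboolP; exists (f %% m).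
by rewrite leqNgt -mN ltn_modp m0.
Qed.

(** * Normalising the moments of a chain *)

Lemma phi_comp w a t f j : phi w (a * (f \Po t) * t ^+ j) =
  \sum_(l < size f) f`_l * phi w (a * t ^+ (l + j)).
Proof.
have phi_sum (I : finType) (G : I -> {poly C}) : phi w (\sum_i G i) = \sum_i phi w (G i).
  by apply: (big_morph (phi w) (phiD w) (phi0 w)).
rewrite comp_polyE mulr_sumr mulr_suml phi_sum; apply: eq_bigr => l _.
rewrite [RHS]mulrC -phiMC exprD -mul_polyC; congr (phi w _).
by rewrite !mulrA [a * _]mulrC -!mulrA mulrC !mulrA.
Qed.

Lemma normalize_complex w a t K :
  (forall j, (K < j)%N -> phi w (a * t ^+ j) = 0) -> phi w (a * t ^+ K) != 0 ->
  exists g : {poly C}, forall j,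
    phi w (a * ((g * g) \Po t) * t ^+ j) = if j == K then 1 else 0.
Proof.
move=> c0 cK; have [||g gE] := @hankel_sqrt C (fun j => phi w (a * t ^+ j)) K
  (sqrtC (phi w (a * t ^+ K)))^-1 1 (C2_neq0 _) _ cK _ c0.
- by rewrite invr_eq0 sqrtC_eq0.
- by rewrite exprVn sqrtCK mulVf.
by exists g => j; rewrite phi_comp gE.
Qed.

Definition sgC (e : bool) : C := if e then -1 else 1.

(** Self-conjugate [a] and [t] have real moments, so the square root is taken in R and the sign of
    the top moment survives. This is the origin of [eta]. *)
Lemma normalize_real w a t K : cpoly a = a -> cpoly t = t ->
  (forall j, (K < j)%N -> phi w (a * t ^+ j) = 0) -> phi w (a * t ^+ K) != 0 ->
  exists (g : {poly C}) e, cpoly g = g /\ forall j,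
    phi w (a * ((g * g) \Po t) * t ^+ j) = if j == K then sgC e else 0.
Proof.
move=> aa tt c0 cK; pose d j := complex.Re (phi w (a * t ^+ j)).
have dE j : phi w (a * t ^+ j) = (d j)%:C%C.
  have := phi_conj w (a * t ^+ j); rewrite rmorphM rmorphXn /= aa tt /d.
  case: (phi w _) => x y /= [/eqP]; rewrite -addr_eq0 -mulr2n mulrn_eq0 /= => /eqP ->.
  by [].
have dK : d K != 0 by apply: contra_neq cK => dK; rewrite dE dK.
have [|||g gE] := @hankel_sqrt R d K (Num.sqrt `|d K|)^-1 (Num.sg (d K)) (C2_neq0 _) _ dK.
- by rewrite invr_eq0 sqrtr_eq0 -ltNge normr_gt0.
- by rewrite exprVn sqr_sqrtr // {2}[d K]numEsg mulrCA mulVf ?mulr1 // normr_eq0.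
- by move=> j /c0; rewrite dE => -[].
exists (map_poly RtoC g), (d K < 0); rewrite cpolyRtoC; split=> // j.
rewrite -rmorphM phi_comp size_map_poly.
under eq_bigr => l _ do rewrite coef_map dE -rmorphM.
rewrite -rmorph_sum /= gE; case: (j == K) => //.
rewrite /sgC; case: (ltgtP (d K) 0) => [d0|d0|d0]; last by rewrite d0 eqxx in dK.
  by rewrite ltr0_sg // rmorphN rmorph1.
by rewrite gtr0_sg // rmorph1.
Qed.

(** * Chains of vectors as columns *)

Definition colm k (e : nat -> 'cV[D]_n) : 'M[D]_(n, k) := \matrix_(i, j) e j i 0.

Lemma mul_colm k (B : 'M[D]_n) e : B *m colm k e = colm k (fun p => B *m e p).
Proof.
by apply/matrixP => i j; rewrite mxE [RHS]mxE mxE; apply: eq_bigr => l _; rewrite mxE.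
Qed.

Lemma eq_colm k e e' : (forall p, (p < k)%N -> e p = e' p) -> colm k e = colm k e'.
Proof. by move=> ee'; apply/matrixP => i j; rewrite !mxE ee'. Qed.

Lemma colm_gram k k' e e' :
  adj (colm k e) *m H *m colm k' e' = \matrix_(i, j) herm H (e i) (e' j).
Proof.
apply/matrixP => i j; rewrite -mulmxA mul_colm [RHS]mxE /herm -mulmxA mxE [RHS]mxE.
by apply: eq_bigr => l _; rewrite !adjE !mxE.
Qed.

Lemma colm_toepX k e :
  colm k e *m toep k 'X = colm k (fun p => if p is p'.+1 then e p' else 0).
Proof.
apply/matrixP => i j; rewrite [RHS]mxE mxE; case jE: (nat_of_ord j) => [|j'].
  rewrite big1 ?mxE // => l _; rewrite !mxE jE leqn0 coefX sub0n.
  by case: ifP; rewrite ?rmorph0 mulr0.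
have j'k : (j' < k)%N by rewrite -ltnS -jE ltnS ltnW.
rewrite (bigD1 (Ordinal j'k)) //= big1 ?addr0 => [|l lj].
  by rewrite !mxE jE /= leqnSn coefX subSnn rmorph1 mulr1.
rewrite !mxE jE coefX; case: leqP => [lj'|]; last by rewrite mulr0.
case: eqP => [ll|]; last by rewrite rmorph0 mulr0.
by case/eqP: lj; apply/val_inj => /=; lia.
Qed.

Lemma colm_toepC k e c : colm k e *m toep k c%:P = colm k (fun p => e p *m (iota c)%:M).
Proof.
apply/matrixP => i j; rewrite [RHS]mxE !mxE (bigD1 j) //= big1 ?addr0 => [|l lj].
  by rewrite !mxE leqnn subnn coefC big_ord1 mxE eqxx mulr1n.
rewrite !mxE coefC subn_eq0; case: leqP => [lj'|]; last by rewrite mulr0.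
case: leqP => [jl|]; last by rewrite rmorph0 mulr0.
by case/eqP: lj; apply/val_inj => /=; lia.
Qed.

Lemma colmD k e e' : colm k e + colm k e' = colm k (fun p => e p + e' p).
Proof. by apply/matrixP => i j; rewrite !mxE. Qed.

(** Listed by decreasing powers of [t], the chain is moved by [t] as by the shift [N], its first
    vector going to 0. So anything congruent to [s(t)] modulo the annihilator of [h] acts as
    [s(N)]. *)
Lemma chain_act h t y s w K : kills (h * t ^+ K.+1) -> kills (h * (y - (s \Po t))) ->
  colm K.+1 (fun p => act (h * t ^+ (K - p) * y) w) =
  colm K.+1 (fun p => act (h * t ^+ (K - p)) w) *m toep K.+1 s.
Proof.
move=> ht hy; transitivity (colm K.+1 (fun p => act (h * t ^+ (K - p) * (s \Po t)) w)).
  apply: eq_colm => p _; rewrite -[in LHS](subrK (s \Po t) y) mulrDr actD.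
  have -> : h * t ^+ (K - p) * (y - (s \Po t)) = t ^+ (K - p) * (h * (y - (s \Po t))) by ring.
  by rewrite (kills_mul _ hy) add0r.
elim/poly_ind: s {y hy} => [|s c IHs].
  rewrite toep0 mulmx0 comp_poly0; apply/matrixP => i j; rewrite !mxE mulr0 act0 mxE //.
rewrite toepD -toepM mulmxDr mulmxA -IHs colm_toepX colm_toepC colmD.
apply: eq_colm => p pK; rewrite comp_poly_MXaddC mulrDr actD actMC; congr (_ + _).
case: p pK => [|p] pK.
  have -> : h * t ^+ (K - 0) * ((s \Po t) * t) = (s \Po t) * (h * t ^+ K.+1).
    by rewrite subn0 exprS; ring.
  exact: kills_mul.
have -> : t ^+ (K - p) = t ^+ (K - p.+1) * t by rewrite -exprSr; congr (t ^+ _); lia.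
by congr (act _ w); ring.
Qed.

Definition split_block := exists (g : cgroup R) (E : 'M[D]_(n, cg_size g)) M,
  [/\ cg_valid g, adj E *m H *m E = blkH g, A *m E = E *m M & blk_root M].

(** [E] is injective because its Gram matrix is invertible, so [M^2 = blkB g] can be read off from
    [A^2 E]. *)
Lemma split_nonzero (g : cgroup R) (E : 'M[D]_(n, cg_size g)) M : cg_valid g ->
  (if g is (GZodd _ _ | GZeven _) then false else true) ->
  adj E *m H *m E = blkH g -> A *m E = E *m M -> A *m A *m E = E *m blkB g -> split_block.
Proof.
move=> gv g0 EHE AE AAE; exists g, E, M; split=> //; apply: blk_root_nonzero => //.
have PE : blkH g *m adj E *m H *m E = 1%:M.
  by rewrite -!mulmxA (mulmxA (adj E)) EHE blkH_inv.
have EMM : E *m (M *m M) = E *m blkB g by rewrite -AAE mulmxA -AE -mulmxA -AE mulmxA.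
by rewrite -[LHS]mul1mx -[RHS]mul1mx -PE -!mulmxA EMM.
Qed.

Lemma primary_split (m : {poly C}) lam : m != 0 -> root m lam ->
  exists K r, m = r * ('X - lam%:P) ^+ K.+1 /\ ~~ root r lam.
Proof.
move=> m0 rm; have [[|K] [r]] := multiplicity_XsubC m lam; rewrite m0 /= => nr mE.
  by rewrite mE expr0 mulr1 (negPf nr) in rm.
by exists K, r.
Qed.

(** After cancelling [r], the left side has a root of multiplicity [K + 1] at [lam] and the right
    side only one of multiplicity [K]. *)
Lemma not_dvd_primary (m r b v : {poly C}) lam K : m = r * ('X - lam%:P) ^+ K.+1 ->
  m != 0 -> ~~ root b lam -> ~~ root v lam ->
  ~ m %| r * b * (('X - lam%:P) * v) ^+ K.
Proof.
move=> mE m0 nb nv; have r0 : r != 0 by apply: contra_neq m0 => r0; rewrite mE r0 mul0r.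
have l0 : ('X - lam%:P) ^+ K != 0 by rewrite expf_neq0 // polyXsubC_eq0.
rewrite mE exprMn -mulrA dvdp_mul2l // mulrCA exprSr dvdp_mul2l //.
apply/negP; rewrite dvdp_XsubCl rootM negb_or nb /=.
by apply: contra nv; rewrite /root horner_exp expf_eq0 => /andP[].
Qed.

(* [X] is congruent to a polynomial [s] in [t = X^2 - lam^2] modulo [(X - lam)^k], because
   [t + lam^2] has a square root in powers of [t] with constant term [lam]. *)
Lemma X_comp_sqrt lam K : lam != 0 -> exists s : {poly C},
  ('X - lam%:P) ^+ K.+1 %| 'X - (s \Po ('X ^+ 2 - (lam ^+ 2)%:P)).
Proof.
(* Starting the inverse root at [lam^-1] selects the branch with constant term [lam] instead of
   [-lam]. *)
move=> l0; have [||s [u [q [q' [s0 sE _]]]]] := @sqrt_trunc C ('X + (lam ^+ 2)%:P) lam^-1 K.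
- exact: C2_neq0.
- by rewrite coef0_jordan exprVn mulVf // expf_neq0.
rewrite coef0_jordan expr2 mulKf // in s0; exists s.
set t := 'X ^+ 2 - _.
have tEfactor : t = ('X - lam%:P) * ('X + lam%:P) by rewrite /t rmorphXn; ring.
have stE : (s \Po t) ^+ 2 = 'X ^+ 2 + (q \Po t) * t ^+ K.+1.
  have := congr1 (fun p : {poly C} => p \Po t) sE.
  rewrite !(rmorphXn, rmorphD, rmorphM) /= comp_polyX comp_polyC => ->.
  by rewrite {1}/t rmorphXn; ring.
(* The product is [X^2 - s(t)^2], a multiple of [t^(K+1)], and its second factor takes the value
   [2 lam] at [lam], so the divisor falls on the first. *)
have : ('X - lam%:P) ^+ K.+1 %| ('X - (s \Po t)) * ('X + (s \Po t)).
  have -> : ('X - (s \Po t)) * ('X + (s \Po t)) = 'X ^+ 2 - (s \Po t) ^+ 2 by ring.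
  rewrite stE opprD addrA subrr sub0r dvdpNr tEfactor exprMn mulrCA.
  exact: dvdp_mulr.
rewrite Gauss_dvdpl // coprimep_expl // coprimep_sym coprimep_XsubC.
have t0 : t.[lam] = 0 by rewrite /t hornerD hornerN hornerXn hornerC subrr.
rewrite /root hornerD hornerX horner_comp t0 horner_coef0 s0 -mulr2n mulrn_eq0 /=.
exact: l0.
Qed.

(** Entries depend only on the exponent [2K - i - j], which equals [K] exactly on the
    antidiagonal. *)
Lemma herm_chain_real h t w K e : cpoly t = t ->
  (forall j, phi w (cpoly h * h * t ^+ j) = if j == K then sgC e else 0) ->
  adj (colm K.+1 (fun p => act (h * t ^+ (K - p)) w)) *m H *m
    colm K.+1 (fun p => act (h * t ^+ (K - p)) w) = sgd e *: sip K.+1.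
Proof.
move=> tt hE; rewrite colm_gram; apply/matrixP => i j; rewrite !mxE herm_act.
rewrite rmorphM rmorphXn /= tt.
have -> : cpoly h * t ^+ (K - i) * (h * t ^+ (K - j)) = cpoly h * h * t ^+ (K - i + (K - j)).
  by rewrite exprD; ring.
rewrite hE; have := ltn_ord i; have := ltn_ord j => jK iK.
have -> : (K - i + (K - j) == K)%N = (i + j == K)%N by lia.
case: eqP => _; last by rewrite mulr0 rmorph0.
by rewrite mulr1 /sgC /sgd; case: e {hE}; rewrite ?rmorphN rmorph1.
Qed.

(** The cofactor [v] covers two cases: [X + lam] for nonzero [lam], making [t = X^2 - lam^2], and 1
    for [lam = 0], making [t = X]. The moment of order [K] survives for some [w] by
    [not_dvd_primary]; the higher ones contain [m]. *)
Lemma real_chain (m r v : {poly C}) (lam : C) K :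
  kills m -> (forall f, kills f -> m %| f) -> m != 0 ->
  m = r * ('X - lam%:P) ^+ K.+1 -> ~~ root r lam -> conjc lam = lam ->
  ~~ root v lam -> cpoly v = v -> let t := ('X - lam%:P) * v in
  exists w h e, m %| h * ('X - lam%:P) ^+ K.+1 /\
  forall j, phi w (cpoly h * h * t ^+ j) = if j == K then sgC e else 0.
Proof.
move=> km mk m0 mE nr ll nv vv t.
have tt : cpoly t = t by rewrite /t rmorphM rmorphB /= map_polyX map_polyC /= ll vv.
have ncr : ~~ root (cpoly r) lam by rewrite complex_root_conj ll.
have [w wK] : exists w, phi w (r * cpoly r * t ^+ K) != 0.
  by apply: not_kills => /mk; apply: not_dvd_primary mE m0 ncr nv.
have wj j : (K < j)%N -> phi w (r * cpoly r * t ^+ j) = 0.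
  move=> Kj; apply: kills_phi.
  have -> : r * cpoly r * t ^+ j = (cpoly r * t ^+ (j - K.+1) * v ^+ K.+1) * m.
    have -> : t ^+ j = t ^+ (j - K.+1) * (('X - lam%:P) ^+ K.+1 * v ^+ K.+1).
      by rewrite -exprMn -exprD subnK.
    by rewrite mE; ring.
  exact: kills_mul.
have aa : cpoly (r * cpoly r) = r * cpoly r by rewrite rmorphM /= cpolyK mulrC.
have [g [e [gg gE]]] := normalize_real aa tt wj wK.
exists w, (r * (g \Po t)), e; split=> [|j].
  by rewrite mE mulrAC; apply: dvdp_mulr.
rewrite -gE; congr (phi w (_ * _)); rewrite rmorphM /= map_comp_poly tt gg rmorphM /=; ring.
Qed.

Lemma act_mulX2 f w : act (f * 'X ^+ 2) w = A *m A *m act f w.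
Proof. by rewrite expr2 mulrA !actMX mulmxA. Qed.

Lemma chain_A h s mu w K (t := 'X ^+ 2 - mu%:P) : kills (h * t ^+ K.+1) ->
  kills (h * ('X - (s \Po t))) ->
  let E := colm K.+1 (fun p => act (h * t ^+ (K - p)) w) in
  A *m E = E *m toep K.+1 s /\ A *m A *m E = E *m jordan K.+1 mu.
Proof.
move=> ht hs E; split.
  rewrite -(chain_act w ht hs) mul_colm; apply: eq_colm => p _.
  by rewrite actMX.
have hy : kills (h * ('X ^+ 2 - (('X + mu%:P) \Po t))).
  rewrite comp_polyD comp_polyX comp_polyC /t subrK subrr mulr0 => u.
  exact: act0.
rewrite /jordan -(chain_act w ht hy) mul_colm; apply: eq_colm => p _.
by rewrite act_mulX2.
Qed.

(** * The block split off at one root of the minimal polynomial *)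

Section Eigenvalue.
Variables (m r : {poly C}) (lam : C) (K : nat).
Hypotheses (m0 : m != 0) (killsP : forall f, kills f <-> m %| f).
Hypotheses (mE : m = r * ('X - lam%:P) ^+ K.+1) (nr : ~~ root r lam).

Let t := 'X ^+ 2 - (lam ^+ 2)%:P.

Lemma tEfactor : t = ('X - lam%:P) * ('X + lam%:P).
Proof. by rewrite /t rmorphXn; ring. Qed.

Lemma kills_chain h : m %| h * ('X - lam%:P) ^+ K.+1 -> lam != 0 ->
  kills (h * t ^+ K.+1) /\ exists s, kills (h * ('X - (s \Po t))).
Proof.
move=> mh l0; split.
  by apply/killsP; rewrite tEfactor exprMn mulrA; apply: dvdp_mulr.
have [s ds] := X_comp_sqrt K l0; exists s; apply/killsP.
by apply: dvdp_trans mh _; apply: dvdp_mul.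
Qed.

Lemma split_real : lam != 0 -> conjc lam = lam -> split_block.
Proof.
move=> l0 ll; have mk f : kills f -> m %| f by move/killsP.
have km : kills m by apply/killsP.
have nv : ~~ root ('X + lam%:P) lam.
  by rewrite /root hornerD hornerX hornerC -mulr2n mulrn_eq0.
have vv : cpoly ('X + lam%:P) = 'X + lam%:P by rewrite rmorphD /= map_polyX map_polyC /= ll.
have [w [h [e [mh hE]]]] := real_chain km mk m0 mE nr ll nv vv.
rewrite -tEfactor in hE; have [ht [s hs]] := kills_chain mh l0.
have tt : cpoly t = t.
  by rewrite /t rmorphB /= map_polyXn map_polyC /= rmorphXn /= ll.
have [E [EHE AE AAE]] : exists E : 'M[D]_(n, K.+1), [/\ adj E *m H *m E = sgd e *: sip K.+1,
    A *m E = E *m toep K.+1 s & A *m A *m E = E *m jordan K.+1 (lam ^+ 2)].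
  have [AE AAE] := chain_A w ht hs.
  by exists (colm K.+1 (fun p => act (h * t ^+ (K - p)) w)); split=> //; apply: herm_chain_real.
have lE : lam ^+ 2 = (complex.Re lam ^+ 2)%:C%C.
  case: lam ll => a b [] /eqP; rewrite eq_sym -addr_eq0 -mulr2n mulrn_eq0 /= => /eqP ->.
  by rewrite rmorphXn.
rewrite lE in AAE.
have a0 : complex.Re lam != 0.
  apply: contra_neq l0 => a0; apply/eqP; rewrite -sqrf_eq0 lE a0 expr0n.
  exact: eqxx.
apply: (@split_nonzero (GPos K.+1 (complex.Re lam ^+ 2) e) _ (toep K.+1 s) _ isT _ AE).
- by rewrite /= lt_def sqrf_eq0 a0 sqr_ge0.
- exact: EHE.
exact: AAE.
Qed.

(** At 0 there is no root of [X^2] in powers of [X^2], so the chain is taken for [A] itself and not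
    for [A^2]. *)
Lemma split_zero_chain : lam = 0 -> exists (x : nat -> 'cV[D]_n) e,
  [/\ forall i, A *m x i = x i.+1, x K.+1 = 0 &
      forall i j, herm H (x i) (x j) = if (i + j == K)%N then sgd e else 0].
Proof.
move=> l0; have mk f : kills f -> m %| f by move/killsP.
have km : kills m by apply/killsP.
have [|||w [h [e [mh hE]]]] := @real_chain m r 1 lam K km mk m0 mE nr.
- by rewrite l0 conjc0.
- by rewrite rootE hornerC oner_eq0.
- by rewrite rmorph1.
exists (fun i => act (h * 'X ^+ i) w), e; split.
- by move=> i; rewrite -actMX -mulrA -exprSr.
- by rewrite l0 subr0 in mh; move/killsP: mh; apply.
move=> i j; rewrite herm_act rmorphM /= map_polyXn.
have -> : cpoly h * 'X ^+ i * (h * 'X ^+ j) = cpoly h * h * (('X - lam%:P) * 1) ^+ (i + j).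
  by rewrite l0 subr0 mulr1 exprD; ring.
by rewrite hE; case: eqP; rewrite ?rmorph0 // /sgC /sgd; case: e {hE}; rewrite ?rmorphN ?rmorph1.
Qed.

Lemma cpoly_min : cpoly m %| m.
Proof.
have /killsP := kills_cpoly (proj2 (killsP m) (dvdpp m)).
by case/dvdpP=> q qE; apply/dvdpP; exists (cpoly q); rewrite -rmorphM -qE /= cpolyK.
Qed.

(** The polynomials annihilating [A] are stable under conjugation, so [r] contains the full primary
    factor at the conjugate of [lam]; hence [m] divides [cpoly r * r]. The latter makes the future
    chains isotropic. *)
Lemma split_complex_chain : conjc lam != lam -> exists w h,
  [/\ m %| h * ('X - lam%:P) ^+ K.+1, m %| cpoly h * h &
      forall j, phi w (h * h * t ^+ j) = if j == K then 1 else 0].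
Proof.
move=> ll; have cm := cpoly_min; have km : kills m by apply/killsP.
have l0 : lam != 0 by apply: contra_neq ll => ->; rewrite conjc0.
have cXl : cpoly ('X - lam%:P) = 'X - (conjc lam)%:P.
  by rewrite rmorphB /= map_polyX map_polyC.
have dr : ('X - (conjc lam)%:P) ^+ K.+1 %| r.
  have : ('X - (conjc lam)%:P) ^+ K.+1 %| m.
    by apply: dvdp_trans cm; rewrite mE rmorphM rmorphXn /= cXl; apply: dvdp_mull.
  rewrite mE Gauss_dvdpl // coprimep_expl // coprimep_expr // coprimep_XsubC.
  by rewrite root_XsubC eq_sym.
have mrr : m %| cpoly r * r.
  have /killsP kcm := kills_cpoly km; apply: dvdp_trans kcm _.
  by rewrite mE rmorphM rmorphXn /= cXl; apply: dvdp_mul.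
have nv : ~~ root ('X + lam%:P) lam.
  by rewrite /root hornerD hornerX hornerC -mulr2n mulrn_eq0.
have [w wK] : exists w, phi w (r * r * t ^+ K) != 0.
  by apply: not_kills => /killsP; rewrite tEfactor; apply: not_dvd_primary mE m0 nr nv.
have wj j : (K < j)%N -> phi w (r * r * t ^+ j) = 0.
  move=> Kj; apply: kills_phi.
  have -> : t ^+ j = t ^+ (j - K.+1) * (('X - lam%:P) ^+ K.+1 * ('X + lam%:P) ^+ K.+1).
    by rewrite -exprMn -tEfactor -exprD subnK.
  have -> : r * r * (t ^+ (j - K.+1) * (('X - lam%:P) ^+ K.+1 * ('X + lam%:P) ^+ K.+1)) =
     r * t ^+ (j - K.+1) * ('X + lam%:P) ^+ K.+1 * m by rewrite mE; ring.
  exact: kills_mul.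
have [g gE] := normalize_complex wj wK.
exists w, (r * (g \Po t)); split=> [||j].
- by rewrite mE mulrAC; apply: dvdp_mulr.
- by rewrite rmorphM mulrACA; apply: dvdp_mulr.
by rewrite -gE; congr (phi w (_ * _)); rewrite rmorphM /=; ring.
Qed.

(** [E] is the chain of [h] and [F] that of [cpoly h]. Within each, Gram entries contain
    [cpoly h * h] and vanish; across, they are the normalised moments of [h * h]. *)
Lemma split_complex_pair : conjc lam != lam -> exists (E F : 'M[D]_(n, K.+1)) s,
  [/\ [/\ adj E *m H *m E = 0, adj F *m H *m F = 0, adj E *m H *m F = sip K.+1 &
       adj F *m H *m E = sip K.+1],
      A *m E = E *m toep K.+1 s /\ A *m F = F *m toep K.+1 (cpoly s) &
      A *m A *m E = E *m jordan K.+1 (lam ^+ 2) /\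
      A *m A *m F = F *m jordan K.+1 (conjc (lam ^+ 2))].
Proof.
move=> ll; have [w [h [mh mhh hE]]] := split_complex_chain ll.
have l0 : lam != 0 by apply: contra_neq ll => ->; rewrite conjc0.
have [ht [s hs]] := kills_chain mh l0.
have ct : cpoly t = 'X ^+ 2 - (conjc (lam ^+ 2))%:P.
  by rewrite /t rmorphB /= map_polyXn map_polyC.
have cht : kills (cpoly h * ('X ^+ 2 - (conjc (lam ^+ 2))%:P) ^+ K.+1).
  by rewrite -ct -rmorphXn -rmorphM /=; apply: kills_cpoly.
have chs : kills (cpoly h * ('X - (cpoly s \Po ('X ^+ 2 - (conjc (lam ^+ 2))%:P)))).
  by rewrite -ct -map_comp_poly -(map_polyX (conjc : {rmorphism C -> C})) -rmorphB -rmorphM;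
    apply: kills_cpoly.
have [AE AAE] := chain_A w ht hs.
have [AF AAF] := chain_A w cht chs.
pose E := colm K.+1 (fun p => act (h * t ^+ (K - p)) w).
pose F := colm K.+1 (fun p => act (cpoly h * (cpoly t) ^+ (K - p)) w).
have chh f : phi w (f * (cpoly h * h)) = 0.
  by apply: kills_phi; apply: kills_mul; apply/killsP.
have FE : adj F *m H *m E = sip K.+1.
  rewrite colm_gram; apply/matrixP => i j; rewrite !mxE herm_act.
  rewrite rmorphM rmorphXn /= !cpolyK.
  have -> : h * t ^+ (K - i) * (h * t ^+ (K - j)) = h * h * t ^+ (K - i + (K - j)).
    by rewrite exprD; ring.
  rewrite hE; have := ltn_ord i; have := ltn_ord j => jK iK.
  have -> : (K - i + (K - j) == K)%N = (i + j == K)%N by lia.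
  by case: eqP; rewrite ?rmorph0 ?rmorph1.
exists E, F, s; split; [split=> // | split=> // | split=> //].
- rewrite colm_gram; apply/matrixP => i j; rewrite !mxE herm_act rmorphM rmorphXn /=.
  have -> : cpoly h * cpoly t ^+ (K - i) * (h * t ^+ (K - j)) =
    cpoly t ^+ (K - i) * t ^+ (K - j) * (cpoly h * h) by ring.
  by rewrite chh rmorph0.
- rewrite colm_gram; apply/matrixP => i j; rewrite !mxE herm_act rmorphM rmorphXn /= !cpolyK.
  have -> : h * t ^+ (K - i) * (cpoly h * cpoly t ^+ (K - j)) =
    t ^+ (K - i) * cpoly t ^+ (K - j) * (cpoly h * h) by ring.
  by rewrite chh rmorph0.
- by have := congr1 (@adj _ _) FE; rewrite !adjM adjK Hadj adj_sip mulmxA.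
- by rewrite /F ct.
- by rewrite /F ct.
Qed.

Lemma row_mx_gram k1 k2 (E : 'M[D]_(n, k1)) (F : 'M[D]_(n, k2)) :
  adj (row_mx E F) *m H *m row_mx E F =
  block_mx (adj E *m H *m E) (adj E *m H *m F) (adj F *m H *m E) (adj F *m H *m F).
Proof. by rewrite adj_row_mx [X in X *m _]mul_col_mx mul_col_row. Qed.

Lemma mul_row_diag k1 k2 (E : 'M[D]_(n, k1)) (F : 'M[D]_(n, k2)) (M : 'M_k1) (N : 'M_k2) :
  row_mx E F *m block_mx M 0 0 N = row_mx (E *m M) (F *m N).
Proof. by rewrite mul_row_block !mulmx0 addr0 add0r. Qed.

Lemma split_complex : conjc lam != lam -> 0 <= complex.Re lam * complex.Im lam -> split_block.
Proof.
move=> ll pos; have [E [F [s [[EE FF EF FE] [AE AF] [AAE AAF]]]]] := split_complex_pair ll.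
have EFgram : adj (row_mx E F) *m H *m row_mx E F = block_mx 0 (sip K.+1) (sip K.+1) 0.
  by rewrite row_mx_gram EE FF EF FE.
have AEF : A *m row_mx E F = row_mx E F *m block_mx (toep K.+1 s) 0 0 (toep K.+1 (cpoly s)).
  by rewrite mul_row_diag mul_mx_row AE AF.
have AAEF : A *m A *m row_mx E F = row_mx E F *m
    block_mx (jordan K.+1 (lam ^+ 2)) 0 0 (jordan K.+1 (conjc (lam ^+ 2))).
  by rewrite mul_row_diag mul_mx_row AAE AAF.
have [a [b [lE b0]]] : exists a b, lam = Complex a b /\ b != 0.
  move: ll; case: (lam) => a b ll; exists a, b; split=> //.
  by apply: contra_neq ll => -> /=; rewrite oppr0.
have l2 : lam ^+ 2 = Complex (a ^+ 2 - b ^+ 2) (a * b + a * b).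
  by rewrite lE expr2; apply/eqP; rewrite eq_complex /=; apply/andP; split; apply/eqP; ring.
rewrite lE /= in pos.
have AAEF2 := AAEF; rewrite l2 /= in AAEF2.
(* For [lam = a + b i] the imaginary part of [lam^2] is [2ab]: positive if [a] is nonzero, and
   otherwise [lam^2 = -b^2] and the pair must be rotated into chains of opposite signs. *)
have [a0|a0] := eqVneq a 0; last first.
  apply: (@split_nonzero (GCpx K.+1 (a ^+ 2 - b ^+ 2) (a * b + a * b)) (row_mx E F) _ _ isT _ AEF).
  - by rewrite /= -mulr2n pmulrn_lgt0 // lt_def mulf_neq0.
  - exact: EFgram.
  exact: AAEF2.
have [c [cc c']] := half_sqrt.
have l2' : lam ^+ 2 = (- b ^+ 2)%:C%C.
  by rewrite l2 a0 mul0r addr0 expr0n sub0r.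
have l2c : conjc (lam ^+ 2) = lam ^+ 2 by rewrite l2' /= oppr0.
rewrite l2c in AAEF.
apply: (@split_nonzero (GNeg K.+1 (- b ^+ 2)) (row_mx E F *m rot K.+1 c)
  (rot_inv K.+1 c *m block_mx (toep K.+1 s) 0 0 (toep K.+1 (cpoly s)) *m rot K.+1 c) _ isT).
- by rewrite /= oppr_lt0 lt_def sqrf_eq0 b0 sqr_ge0.
- rewrite adjM -!mulmxA (mulmxA H) (mulmxA (adj (row_mx E F))) (mulmxA (adj (row_mx E F)) H).
  by rewrite EFgram mulmxA rot_gram.
- by rewrite mulmxA AEF -!(mulmxA (row_mx E F)) rot_conj.
rewrite l2' in AAEF.
by rewrite mulmxA AAEF -!(mulmxA (row_mx E F)) -rot_diag.
Qed.

Lemma colm_downP k e : colm k.+1 e *m downP k = colm k e.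
Proof.
apply/matrixP => i j; rewrite mxE (bigD1 (widen_ord (leqnSn k) j)) //= big1 ?addr0 => [|l lj].
  by rewrite !mxE /= eqxx mulr1.
rewrite !mxE; case: eqP => [ll|]; last by rewrite mulr0.
by case/eqP: lj; apply/val_inj.
Qed.

Lemma colm_shiftP k e :
  colm k e *m shiftP k = colm k.+1 (fun p => if p is p'.+1 then e p' else 0).
Proof.
apply/matrixP => i j; rewrite [RHS]mxE mxE; case jE: (nat_of_ord j) => [|j'].
  by rewrite big1 ?mxE // => l _; rewrite !mxE jE mulr0.
have j'k : (j' < k)%N by rewrite -ltnS -jE.
rewrite (bigD1 (Ordinal j'k)) //= big1 ?addr0 => [|l lj].
  by rewrite !mxE jE /= eqxx mulr1.
rewrite !mxE jE; case: eqP => [[ll]|]; last by rewrite mulr0.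
by case/eqP: lj; apply/val_inj => /=.
Qed.

(** [[x_i, x_j]] is nonzero only for [i + j = K]. If [K] is even, vectors of even and odd index are
    orthogonal and form chains of [A^2] of lengths [p + 1] and [p]; if [K] is odd, each family is
    isotropic, both have length [p + 1], and they are dual to each other. *)
Lemma split_zero : lam = 0 -> split_block.
Proof.
move=> /split_zero_chain[x [e [Ax x0 xx]]].
pose p := K./2.
have [oK|eK] := boolP (odd K); last first.
  have Kp : K = p.*2 by rewrite -[LHS]odd_double_half (negPf eK).
  pose E := colm p.+1 (fun j => x (p - j).*2).
  pose F := colm p (fun j => x (p - j.+1).*2.+1).
  have gram k (y z : nat -> nat) :
      (forall i j : 'I_k, (y i + z j == K)%N = (i + j == k.-1)%N) ->
      adj (colm k (fun j => x (y j))) *m H *m colm k (fun j => x (z j)) = sgd e *: sip k.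
    move=> yz; rewrite colm_gram; apply/matrixP => i j; rewrite !mxE xx yz.
    by case: eqP; rewrite ?mulr1 ?mulr0.
  have gram0 k1 k2 (y z : nat -> nat) : (forall i j, odd (y i + z j)) ->
      adj (colm k1 (fun j => x (y j))) *m H *m colm k2 (fun j => x (z j)) = 0.
    move=> yz; rewrite colm_gram; apply/matrixP => i j; rewrite !mxE xx.
    by case: eqP => // E'; have := yz i j; rewrite E' (negPf eK).
  exists (GZodd R p e), (row_mx E F), (rootodd p); split=> //.
  - rewrite row_mx_gram /blkH; congr block_mx.
    + apply: gram => // i j; have := ltn_ord i; have := ltn_ord j; lia.
    + by apply: gram0 => i j; rewrite addnS /= oddD !odd_double.
    + by apply: gram0 => i j; rewrite addSn /= oddD !odd_double.
    + apply: gram => // i j; have := ltn_ord i; have := ltn_ord j; lia.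
  - rewrite /rootodd mul_mx_row mul_row_block !mulmx0 addr0 add0r colm_downP colm_shiftP.
    rewrite !mul_colm; congr row_mx; apply: eq_colm => -[|j] jp; rewrite Ax //.
    + by rewrite subn0 -Kp x0.
    + by rewrite -doubleS; congr (x _.*2); lia.
    + by rewrite -doubleS; congr (x _.*2); lia.
  exact: rootodd_root.
have Kp : K = p.*2.+1 by rewrite -[LHS]odd_double_half oK.
pose a := colm p.+1 (fun j => x (p - j).*2).
pose b := colm p.+1 (fun j => x (p - j).*2.+1).
have [c [cc c']] := half_sqrt.
have Aa : A *m a = b by rewrite /a /b mul_colm; apply: eq_colm => j _; rewrite Ax.
have Ab : A *m b = a *m toep p.+1 'X.
  rewrite /a /b colm_toepX mul_colm; apply: eq_colm => -[|j] jp; rewrite Ax.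
    by rewrite subn0 -doubleS -x0 Kp.
  by rewrite -doubleS; congr (x _.*2); lia.
have ab : adj a *m H *m b = sgd e *: sip p.+1.
  rewrite /a /b colm_gram; apply/matrixP => i j; rewrite !mxE xx.
  have -> : ((p - i).*2 + (p - j).*2.+1 == K)%N = (i + j == p)%N.
    by have := ltn_ord i; have := ltn_ord j; lia.
  by case: eqP; rewrite ?mulr1 ?mulr0.
have ba : adj b *m H *m a = sgd e *: sip p.+1.
  by have := congr1 (@adj _ _) ab; rewrite !adjM adjK Hadj adj_scale_sgd adj_sip mulmxA.
have aa : adj a *m H *m a = 0.
  rewrite /a colm_gram; apply/matrixP => i j; rewrite !mxE xx.
  by case: eqP => // E'; have := congr1 odd E'; rewrite oddD !odd_double oK.
have bb : adj b *m H *m b = 0.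
  rewrite /a /b colm_gram; apply/matrixP => i j; rewrite !mxE xx.
  by case: eqP => // E'; have := congr1 odd E'; rewrite oddD /= !odd_double oK.
(* The sign makes the pairing exactly [Q] and reappears as a factor in the matrix of [A]. The kernel
   vector [x K], first column of [b], is after rotation proportional to the sum of the first vectors
   of both chains. *)
pose ab' := row_mx a (sgd e *: b).
have A_ab : A *m ab' = ab' *m (sgd e *: block_mx 0 (toep p.+1 'X) 1%:M 0).
  rewrite scalemx_sgdr /ab' mul_mx_row mul_row_block !mulmx0 !add0r addr0 mulmx1 scalemx_sgdr.
  by rewrite Aa Ab scale_row_mx scalerA sgd_sgd scale1r.
have ab_gram : adj ab' *m H *m ab' = block_mx 0 (sip p.+1) (sip p.+1) 0.
  rewrite /ab' row_mx_gram adj_scale_sgd -!scalemxAl !scalemx_sgdr aa ab ba bb.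
  by rewrite !scalerA sgd_sgd !scale1r.
exists (GZeven R p.+1), (ab' *m rot p.+1 c), (sgd e *: rooteven p.+1 (c * c)); split=> //.
- rewrite adjM -!mulmxA (mulmxA H) (mulmxA (adj ab')) (mulmxA (adj ab') H).
  by rewrite ab_gram mulmxA rot_gram.
- by rewrite mulmxA A_ab -rot_even !scalemx_sgdr -scalemxAl -!(mulmxA ab') rot_conj.
by apply: blk_root_sgd; apply: rooteven_root.
Qed.

End Eigenvalue.

(** * Existence of the canonical form for a selfadjoint A *)

Lemma split_exists : (0 < n)%N -> split_block.
Proof.
move=> n0; have [m [m0 km killsP]] := min_kills.
have root_of : exists lam, root m lam.
  apply/closed_rootP/negP => /size_poly1P[c c0 mE].
  have w0 : (0 : 'cV[D]_n) = const_mx 1.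
    have := km (const_mx (iota c^-1)); rewrite mE actC => <-; apply/colP => i.
    by rewrite mxE big_ord1 !mxE eqxx mulr1n -rmorphM mulVf ?rmorph1.
  by have /colP/(_ (Ordinal n0)) := w0; rewrite !mxE => /esym/eqP; rewrite oner_eq0.
have root_conj lam : root m lam -> root m (conjc lam).
  move=> ml; rewrite -dvdp_XsubCl; apply: dvdp_trans (cpoly_min killsP).
  by rewrite dvdp_XsubCl complex_root_conj conjcK.
(* Replacing [lam] by its conjugate if necessary makes the imaginary part of [lam^2] nonnegative, as
   complex blocks demand. *)
have [lam [ml sgn]] : exists lam, root m lam /\ 0 <= complex.Re lam * complex.Im lam.
  have [lam ml] := root_of.
  have [|neg] := lerP 0 (complex.Re lam * complex.Im lam); first by exists lam.
  exists (conjc lam); split; first exact: root_conj.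
  by case: lam ml neg => a b _ /= neg; rewrite mulrN oppr_ge0 ltW.
have [K [r [mE nr]]] := primary_split m0 ml.
have [l0|l0] := eqVneq lam 0; first exact: split_zero m0 killsP mE nr l0.
have [ll|ll] := eqVneq (conjc lam) lam; first exact: split_real m0 killsP mE nr l0 ll.
exact: split_complex m0 killsP mE nr ll sgn.
Qed.

End Cyclic.

Lemma canonical_exists n (H Hinv A : 'M[D]_n) :
  adj H = H -> H *m Hinv = 1%:M -> Hinv *m H = 1%:M -> adj A *m H = H *m A ->
  exists s, canonical H (A *m A) A s.
Proof.
elim/ltn_ind: n H Hinv A => n IHn H Hinv A Hadj HHinv HinvH AH.
case: (posnP n) => [n0|n0].
  subst n; exists [::], 0, 0; split=> //; try by [split; apply/matrixP => -[]].
  - by apply/matrixP => -[].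
  - by apply/matrixP => -[].
  by move=> v; split=> _; [exists 0|]; apply/matrixP => -[].
have [g [E [M [gv EHE AE rM]]]] := split_exists Hadj HHinv AH n0.
apply: (canonical_step Hadj HHinv HinvH AH gv EHE AE rM).
by move=> n' H' Hinv' A' n'n; apply: IHn.
Qed.

Lemma polar_iff_canonical n (H Hinv X : 'M[D]_n) :
  adj H = H -> H *m Hinv = 1%:M -> Hinv *m H = 1%:M ->
  polar H Hinv X <-> exists s, canonical H (Hinv *m adj X *m H *m X) X s.
Proof.
move=> Hadj HHinv HinvH; split=> [[U [A [UH [AE XE]]]]|[s]]; last exact: polar_of_canonical.
have AH : adj A *m H = H *m A by rewrite -{2}AE !mulmxA HHinv mul1mx.
have [s [S [Sinv [sv SS BS SHS kerA]]]] := canonical_exists Hadj HHinv HinvH AH.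
have BE : Hinv *m adj X *m H *m X = A *m A.
  rewrite XE adjM !mulmxA -(mulmxA (Hinv *m adj A)) -(mulmxA (Hinv *m adj A)) UH.
  by rewrite AE.
exists s, S, Sinv; split=> //; first by rewrite BE.
move=> v; rewrite -kerA XE; split=> [UAv|Av]; last by rewrite -mulmxA Av mulmx0.
rewrite -[LHS]mul1mx -HinvH -[in LHS]UH -!mulmxA (mulmxA U) UAv.
by rewrite !mulmx0.
Qed.

End Skew.

(** * The quaternions *)

Section Quaternions.
Variable R : realType.
Local Notation Q := (quat R).

Lemma quatP (p q : Q) :
  [/\ qre p = qre q, qi p = qi q, qj p = qj q & qk p = qk q] -> p = q.
Proof. by case: p q => [????] [????] /= [-> -> -> ->]. Qed.

Lemma qconjB : {morph @qconj R : p q / p - q}.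
Proof. by move=> [????] [????]; apply: quatP; split=> /=; rewrite ?opprD. Qed.
HB.instance Definition _ := GRing.isZmodMorphism.Build Q Q (@qconj R) qconjB.

Lemma qreB : {morph @qre R : p q / p - q}. Proof. by []. Qed.
HB.instance Definition _ := GRing.isZmodMorphism.Build Q R (@qre R) qreB.

Lemma qconjM (p q : Q) : qconj (p * q) = qconj q * qconj p.
Proof. by case: p q => [????] [????]; apply: quatP; split=> /=; ring. Qed.

Lemma qreMC (p q : Q) : qre (p * q) = qre (q * p).
Proof. by case: p q => [????] [????] /=; ring. Qed.

Lemma qconjK : involutive (@qconj R).
Proof. by case=> [????]; apply: quatP; split=> /=; rewrite ?opprK. Qed.

Definition qnorm2 (q : Q) := qre q ^+ 2 + qi q ^+ 2 + qj q ^+ 2 + qk q ^+ 2.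

Lemma qnorm2_eq0 (q : Q) : qnorm2 q = 0 -> q = 0.
Proof.
case: q => a b c d; rewrite /qnorm2 /= => N0.
have := sqr_ge0 a; have := sqr_ge0 b; have := sqr_ge0 c; have := sqr_ge0 d.
move=> *; apply: quatP; split=> /=; apply/eqP; rewrite -sqrf_eq0; apply/eqP; lra.
Qed.

Lemma qmul_conj (q : Q) : q * qconj q = qofR (qnorm2 q).
Proof. by case: q => *; rewrite /qnorm2; apply: quatP; split=> /=; ring. Qed.

Lemma qofR_central (r : R) (q : Q) : qofR r * q = q * qofR r.
Proof. by case: q => *; apply: quatP; split=> /=; ring. Qed.

Lemma qofRM (r s : R) : qofR (r * s) = qofR r * qofR s :> Q.
Proof. by apply: quatP; split=> /=; ring. Qed.

Lemma quat_inv (q : Q) : q != 0 -> {q' : Q | q * q' = 1 & q' * q = 1}.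
Proof.
move=> q0; have N0 : qnorm2 q != 0 by apply: contra_neq q0; apply: qnorm2_eq0.
exists (qconj q * qofR (qnorm2 q)^-1).
  by rewrite mulrA qmul_conj -qofRM divff.
rewrite -qofR_central -mulrA -{3}[q]qconjK qmul_conj.
have -> : qnorm2 (qconj q) = qnorm2 q by rewrite /qnorm2 /= !sqrrN.
by rewrite -qofRM mulVf.
Qed.

Definition quat_of_complex (z : R[i]) : Q := qofC (complex.Re z) (complex.Im z).

Lemma quat_of_complexB : {morph quat_of_complex : y z / y - z}.
Proof. by move=> [a b] [c d]; apply: quatP; split=> /=; rewrite ?subrr. Qed.
HB.instance Definition _ :=
  GRing.isZmodMorphism.Build R[i] Q quat_of_complex quat_of_complexB.

Lemma quat_of_complex_multiplicative : monoid_morphism quat_of_complex.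
Proof. by split=> [//|[a b] [c d]]; apply: quatP; split=> /=; ring. Qed.
HB.instance Definition _ :=
  GRing.isMonoidMorphism.Build R[i] Q quat_of_complex quat_of_complex_multiplicative.

Definition quat_coord (q : Q) : 'rV[R]_4 :=
  \row_i nth 0 [:: qre q; qi q; qj q; qk q] i.

Lemma quat_coordB : {morph quat_coord : p q / p - q}.
Proof.
by move=> p q; apply/rowP => -[[|[|[|[|//]]]] i4]; rewrite !mxE.
Qed.
HB.instance Definition _ := GRing.isZmodMorphism.Build Q 'rV[R]_4 quat_coord quat_coordB.

Lemma quat_polar_iff_canonical n (H Hinv X : 'M[Q]_n) :
  adjq H = H -> H *m Hinv = 1%:M -> Hinv *m H = 1%:M ->
  H_polar_decomposition H Hinv X <->
  exists s, canonical (@qconj R) quat_of_complex H (Hinv *m adjq X *m H *m X) X s.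
Proof.
apply: (@polar_iff_canonical R Q (@qconj R) quat_of_complex (@qre R) quat_coord).
- exact: qconjM.
- exact: qconjK.
- exact: quat_inv.
- by case=> a b; apply: quatP; split=> /=; rewrite ?oppr0.
- by move=> x q; apply: qofR_central.
- by move=> [a b c d] [bE cE dE]; apply: quatP; split=> //=; lra.
- exact: qreMC.
- by [].
- move=> [a b c d] /rowP q0; apply: quatP; split=> /=.
  + by have := q0 0; rewrite !mxE.
  + by have := q0 1; rewrite !mxE.
  + by have := q0 (Ordinal (isT : 2 < 4)%N); rewrite !mxE.
  + by have := q0 (Ordinal (isT : 3 < 4)%N); rewrite !mxE.
move=> x [a b c d]; apply/rowP => -[[|[|[|[|//]]]] i4]; rewrite !mxE /=; ring.
Qed.

(** * Agreement of the index functions with the block matrices *)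

Lemma matrix_dsumF d1 d2 (f g : nat -> nat -> Q) :
  \matrix_(i < d1 + d2, j < d1 + d2) dsumF d1 f g i j =
  block_mx (\matrix_(i, j) f i j) 0 0 (\matrix_(i, j) g i j).
Proof.
apply/matrixP => i j; rewrite mxE /dsumF.
case: (split_ordP i) => i' ->; case: (split_ordP j) => j' -> /=.
- by rewrite block_mxEul mxE.
- by rewrite block_mxEur mxE.
- by rewrite block_mxEdl mxE.
by rewrite block_mxEdr mxE !addKn.
Qed.

Lemma matrix_jordanF k z :
  \matrix_(i < k, j < k) jordanF (quat_of_complex z) i j =
  toep quat_of_complex k ('X + z%:P).
Proof.
apply/matrixP => i j; rewrite !mxE /jordanF coefD coefX coefC.
case: (ltngtP i j) => [ij|ij|->].
- have -> : (j - i == 0)%N = false by lia.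
  rewrite addr0; have -> : (j - i == 1)%N = (j == i.+1 :> nat) by lia.
  by case: eqP; rewrite ?rmorph1 ?rmorph0.
- by rewrite ifF //; apply/eqP; lia.
by rewrite subnn add0r.
Qed.

Lemma matrix_jordanF0 k :
  \matrix_(i < k, j < k) jordanF (0 : Q) i j = toep quat_of_complex k 'X.
Proof. by rewrite -(rmorph0 quat_of_complex) matrix_jordanF addr0. Qed.

Lemma matrix_antidiagF k : \matrix_(i < k, j < k) antidiagF R k i j = sip Q k.
Proof. by apply/matrixP => i j; rewrite !mxE. Qed.

Lemma matrix_scaleF k c (f : nat -> nat -> Q) :
  \matrix_(i < k, j < k) scaleF c f i j = c *: \matrix_(i, j) f i j.
Proof. by apply/matrixP => i j; rewrite !mxE. Qed.

Lemma matrix_antidiagF_double k : \matrix_(i < k + k, j < k + k) antidiagF R (k + k) i j =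
  block_mx 0 (sip Q k) (sip Q k) 0.
Proof.
apply/matrixP => i j; rewrite mxE /antidiagF.
case: (split_ordP i) => i' ->; case: (split_ordP j) => j' -> /=.
- rewrite block_mxEul mxE ifF //; apply/eqP.
  by have := ltn_ord i'; have := ltn_ord j'; lia.
- rewrite block_mxEur mxE; congr (if _ then _ else _).
  by have := ltn_ord i'; have := ltn_ord j'; lia.
- rewrite block_mxEdl mxE; congr (if _ then _ else _).
  by have := ltn_ord i'; have := ltn_ord j'; lia.
rewrite block_mxEdr mxE ifF //; apply/eqP.
by have := ltn_ord i'; have := ltn_ord j'; lia.
Qed.

Lemma matrix_cg_B (g : cgroup R) :
  \matrix_(i < cg_size g, j < cg_size g) cg_B g i j = blkB quat_of_complex g.
Proof.
case: g => [k l e|k a b|k l|k e|k]; rewrite /cg_B ?matrix_dsumF ?matrix_jordanF0 //.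
- by rewrite (matrix_jordanF k l%:C%C).
- by rewrite (matrix_jordanF k (Complex a b)) (matrix_jordanF k (Complex a (- b))).
- by rewrite (matrix_jordanF k l%:C%C).
Qed.

Lemma matrix_cg_H (g : cgroup R) :
  \matrix_(i < cg_size g, j < cg_size g) cg_H g i j = blkH Q g.
Proof.
have signE e : signq R e = sgd Q e by case: e.
case: g => [k l e|k a b|k l|k e|k]; rewrite /cg_H.
- by rewrite matrix_scaleF matrix_antidiagF signE.
- exact: matrix_antidiagF_double.
- by rewrite matrix_dsumF matrix_scaleF matrix_antidiagF scaleN1r.
- by rewrite matrix_dsumF !matrix_scaleF !matrix_antidiagF signE.
by rewrite matrix_dsumF matrix_scaleF matrix_antidiagF scaleN1r.
Qed.

Lemma matrix_canB (s : seq (cgroup R)) :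
  \matrix_(i < can_size s, j < can_size s) canB s i j = canMB quat_of_complex s.
Proof.
elim: s => [|g s IHs]; first by apply/matrixP => -[].
by rewrite [LHS]matrix_dsumF matrix_cg_B IHs.
Qed.

Lemma matrix_canH (s : seq (cgroup R)) :
  \matrix_(i < can_size s, j < can_size s) canH s i j = canMH Q s.
Proof.
elim: s => [|g s IHs]; first by apply/matrixP => -[].
by rewrite [LHS]matrix_dsumF matrix_cg_H IHs.
Qed.

Lemma colsF_cg_ker (g : cgroup R) : colsF (cg_size g) (cg_ker g) = blkK Q g.
Proof.
case: g => [k l e|k a b|k l|k e|k]; try by apply/matrixP => i [].
  apply/matrixP => i j; rewrite mxE [j]ord1 /=.
  by case: (split_ordP i) => i' ->; rewrite ?col_mxEu ?col_mxEd mxE.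
apply/matrixP => i j; rewrite mxE [j]ord1 /= /unitV.
case: (split_ordP i) => i' ->; rewrite ?col_mxEu ?col_mxEd mxE /=.
  by rewrite (ltn_eqF (ltn_ord i')) addr0.
have -> : (k + i' == 0)%N = false by have := ltn_ord i'; lia.
have -> : (k + i' == k)%N = (i' == 0 :> nat) by lia.
by rewrite add0r.
Qed.

(** Coefficients indexed by naturals let lists of generators be concatenated without transporting
    matrix sizes. *)
Lemma colsF_span n (vs : seq (nat -> Q)) (x : 'cV[Q]_n) :
  (exists a, x = colsF n vs *m a) <->
  exists f : nat -> Q, forall i : 'I_n,
    x i 0 = \sum_(0 <= j < size vs) nth (fun _ => 0) vs j i * f j.
Proof.
split=> [[a ->]|[f xE]].
  exists (fun j => if insub j is Some o then a o 0 else 0) => i.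
  rewrite big_mkord mxE; apply: eq_bigr => j _.
  by rewrite mxE valK.
exists (\col_j f j); apply/colP => i; rewrite xE big_mkord mxE.
by apply: eq_bigr => j _; rewrite !mxE.
Qed.

Lemma colsF_cat d n (us vs : seq (nat -> Q)) (x : 'cV[Q]_d) (y : 'cV[Q]_n) :
  (forall j i, (d <= i)%N -> nth (fun _ => 0) us j i = 0) ->
  (exists a, col_mx x y = colsF (d + n) (us ++ map (shiftV d) vs) *m a) <->
  (exists a, x = colsF d us *m a) /\ (exists a, y = colsF n vs *m a).
Proof.
move=> us0; rewrite !colsF_span size_cat size_map.
have sumE f (i : nat) : \sum_(0 <= j < size us + size vs)
     nth (fun _ => 0) (us ++ map (shiftV d) vs) j i * f j =
   \sum_(0 <= j < size us) nth (fun _ => 0) us j i * f j +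
   \sum_(0 <= j < size vs) (shiftV d (nth (fun _ => 0) vs j)) i * f (j + size us)%N.
  rewrite (big_cat_nat (n := size us)) ?leq_addr //=; congr (_ + _).
    by apply: eq_big_nat => j /= jus; rewrite nth_cat jus.
  rewrite -{1}[size us]add0n big_addn addKn; apply: eq_big_nat => j /= jvs.
  by rewrite nth_cat ltnNge leq_addl /= addnK (nth_map (fun _ => 0)).
split=> [[f fE]|[[f fE] [g gE]]].
  split; [exists f => i | exists (fun j => f (j + size us)%N) => i].
    have := fE (lshift n i); rewrite col_mxEu sumE => ->.
    rewrite [X in _ + X]big1 ?addr0 // => j _.
    by rewrite /shiftV /= leqNgt ltn_ord mul0r.
  have := fE (rshift d i); rewrite col_mxEd sumE => ->.
  rewrite big1 ?add0r => [|j _]; last by rewrite us0 ?mul0r //= leq_addr.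
  by apply: eq_bigr => j _; rewrite /shiftV /= leq_addr addKn.
exists (fun j => if (j < size us)%N then f j else g (j - size us)%N) => i.
rewrite sumE; case: (split_ordP i) => i' ->.
  rewrite col_mxEu fE [X in _ + X]big1 ?addr0 => [|j _].
    by apply: eq_big_nat => j /= ->.
  by rewrite /shiftV /= leqNgt ltn_ord mul0r.
rewrite col_mxEd gE [X in X + _]big1 ?add0r => [|j _].
  apply: eq_bigr => j _.
  by rewrite /shiftV /= leq_addr addKn ltnNge leq_addl addnK.
by rewrite us0 ?mul0r //= leq_addr.
Qed.

(** Generators are functions on all naturals and must not spill into the next group. Validity
    matters for [GZeven k], whose unit vector at [k] lies inside the block only if [k] is
    positive. *)
Lemma cg_ker_support (g : cgroup R) j i : cg_valid g -> (cg_size g <= i)%N ->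
  nth (fun _ => 0) (cg_ker g) j i = 0.
Proof.
case: g => [k l e|k a b|k l|k e|k] gv; case: j => [|j] gi; rewrite /= ?nth_nil // /unitV.
  by rewrite gtn_eqF //; apply: leq_trans gi.
by rewrite /= in gv gi; rewrite !gtn_eqF ?addr0 //; lia.
Qed.

Lemma colsF_canKer (s : seq (cgroup R)) (x : 'cV[Q]_(can_size s)) : all (@cg_valid R) s ->
  (exists a, x = colsF (can_size s) (canKer s) *m a) <-> (exists a, x = canMK Q s *m a).
Proof.
elim: s x => [|g s IHs] x.
  by move=> _; split=> _; exists 0; apply/matrixP => -[].
move=> /= /andP[gv sv]; rewrite -[x]vsubmxK; move: (usubmx x) (dsubmx x) => {x} x y.
rewrite colsF_cat => [|j i]; last exact: cg_ker_support.
rewrite (IHs y sv) colsF_cg_ker; split=> [[[a ->] [b ->]]|[a]].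
  by exists (col_mx a b); rewrite block_diag_mul_col.
rewrite -[a]vsubmxK => /esym; rewrite [LHS]block_diag_mul_col => /eq_col_mx[<- <-].
by split; eexists.
Qed.

End Quaternions.

Theorem theorem6p2 (R : realType) (n : nat) (H Hinv X : 'M[quat R]_n) :
  adjq H = H -> H *m Hinv = 1%:M -> Hinv *m H = 1%:M ->
  let B := Hinv *m adjq X *m H *m X in
  H_polar_decomposition H Hinv X <->
  exists (s : seq (cgroup R)) (S Sinv : 'M[quat R]_n),
    [/\ all (@cg_valid R) s, can_size s = n,
        S *m Sinv = 1%:M /\ Sinv *m S = 1%:M,
        Sinv *m B *m S = \matrix_(i, j) canB s i j /\
        adjq S *m H *m S = \matrix_(i, j) canH s i j &
        (forall v : 'cV[quat R]_n,
           X *m v = 0 <->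
           exists a : 'cV[quat R]_(size (canKer s)),
             v = S *m colsF n (canKer s) *m a)].
Proof.
move=> Hadj HHinv HinvH B; rewrite quat_polar_iff_canonical //.
have colsE s (S Sinv : 'M[quat R]_(can_size s)) (v : 'cV_(can_size s)) :
    all (@cg_valid R) s ->
    S *m Sinv = 1%:M -> Sinv *m S = 1%:M ->
    (exists a, v = S *m colsF (can_size s) (canKer s) *m a) <->
    (exists a, v = S *m canMK (quat R) s *m a).
  move=> sv SS' S'S; have tr m (K : 'M_(can_size s, m)) :
      (exists a : 'cV_m, v = S *m K *m a) <-> (exists a, Sinv *m v = K *m a).
    split=> -[a aE]; exists a; first by rewrite aE !mulmxA S'S mul1mx.
    by rewrite -mulmxA -aE mulmxA SS' mul1mx.
  by rewrite !tr; apply: colsF_canKer.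
split=> [[s [S [Sinv [sv [SS' S'S] BS SHS kerX]]]]|[s [S [Sinv [sv sn]]]]].
  (* Once this equality is known, substitution makes [S] square, as the statement requires. *)
  have sn : n = can_size s by apply: (invmx_size (re := @qre R) (@qreMC R) _ SS' S'S).
  subst n; exists s, S, Sinv; split=> //.
    by rewrite matrix_canB matrix_canH -mulmxA BS mulmxA S'S mul1mx.
  by move=> v; rewrite kerX; split=> /(colsE _ _ _ _ sv SS' S'S).
subst n; move=> [SS' S'S] [BS SHS] kerX; exists s, S, Sinv; split=> //.
- by rewrite -matrix_canB -BS !mulmxA SS' mul1mx.
- by rewrite -matrix_canH -SHS.
by move=> v; rewrite kerX; split=> /(colsE _ _ _ _ sv SS' S'S).
Qed.
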